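(* Let $a\in(-1,1)$, let $H$ be the operator in $L^2((-\frac{\pi}{2},\frac{\pi}{2}))$ defined by $H\psi=-\psi''$ on the domain $\mathsf{D}(H)=\{\psi\in H^2((-\frac{\pi}{2},\frac{\pi}{2})) : \psi(-\frac{\pi}{2})=\psi(\frac{\pi}{2}a)=\psi(\frac{\pi}{2})\}$, and let $H^*$ be its adjoint. Set $$\sigma_{\pm1}=\Big\{\Big(\frac{4m}{1\pm a}\Big)^2 : m\in\mathbb{N}^*\Big\},\qquad \sigma_0=\{(2m)^2 : m\in\mathbb{N}\}.$$ Then the point spectrum of $H^*$ is $\sigma_{\mathrm p}(H^* )=\sigma_{-1}\cup\sigma_{+1}\cup\sigma_0$. Moreover, writing $\phi=\begin{pmatrix}\phi_-\\ \phi_+\end{pmatrix}$ for the function equal to $\phi_-$ on $(-\frac{\pi}{2},\frac{\pi}{2}a)$ and to $\phi_+$ on $(\frac{\pi}{2}a,\frac{\pi}{2})$: 1. If $a\notin\mathbb{Q}$, then the sets $\sigma_{-1}$, $\sigma_{+1}$ and $\sigma_0$ are mutually disjoint and each point of the point spectrum is an eigenvalue of $H^*$ of geometric multiplicity one. The associated eigenfunction is, up to a non-zero multiplicative constant, (i) $\begin{pmatrix}0\\ \sin\big(\frac{4m}{1-a}(x-\frac{\pi}{2})\big)\end{pmatrix}$ for the eigenvalue $\big(\frac{4m}{1-a}\big)^2\in\sigma_{-1}$, $m\in\mathbb{N}^*$; (ii) $\begin{pmatrix}\sin\big(\frac{4m}{1+a}(x+\frac{\pi}{2})\big)\\ 0\end{pmatrix}$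 for the eigenvalue $\big(\frac{4m}{1+a}\big)^2\in\sigma_{+1}$, $m\in\mathbb{N}^*$; (iii) $\begin{pmatrix}\sin\big(2m(x+\frac{\pi}{2})\big)\\ \sin\big(2m(x-\frac{\pi}{2})\big)\end{pmatrix}$ for the eigenvalue $(2m)^2\in\sigma_0$, $m\in\mathbb{N}^*$; (iv) $\begin{pmatrix}(a-1)(x+\frac{\pi}{2})\\ (a+1)(x-\frac{\pi}{2})\end{pmatrix}$ for the eigenvalue $0\in\sigma_0$. 2. If $a\in\mathbb{Q}$, then $\sigma_{-1}\cap\sigma_{+1}=\sigma_{-1}\cap\sigma_{+1}\cap\sigma_0\neq\varnothing$. Each point $\lambda=k^2$, $k>0$, of $\sigma_{-1}\cap\sigma_{+1}$ is an eigenvalue of $H^*$ of geometric multiplicity two, with the two linearly independent associated eigenfunctions $\begin{pmatrix}0\\ \sin\big(k(x-\frac{\pi}{2})\big)\end{pmatrix}$ and $\begin{pmatrix}\sin\big(k(x+\frac{\pi}{2})\big)\\ 0\end{pmatrix}$. Each point of $\sigma_{\mathrm p}(H^* )\setminus(\sigma_{-1}\cap\sigma_{+1})$ is an eigenvalue of geometric multiplicity one; the associated eigenfunction is, up to a non-zero multiplicative constant, the function in (i) for an eigenvalue $\big(\frac{4m}{1-a}\big)^2\in\sigma_{-1}$, the function in (ii) for an eigenvalue $\big(\frac{4m}{1+a}\big)^2\in\sigma_{+1}$, the function in (iii) for an eigenvalue $(2m)^2\in\sigma_0$ with $m\in\mathbb{N}^*$, and the function in (iv) for the eigenvalue $0$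 (which is always geometrically simple).
   Context: $\mathbb{N}=\{0,1,2,\dots\}$ and $\mathbb{N}^*=\mathbb{N}\setminus\{0\}$. $L^2((-\frac{\pi}{2},\frac{\pi}{2}))$ is the complex Hilbert space of square-integrable functions and $H^2$ denotes the usual Sobolev space, whose elements are identified with their continuous representatives on $[-\frac{\pi}{2},\frac{\pi}{2}]$. $H^*$ is the Hilbert-space adjoint of the densely defined operator $H$. The point spectrum is the set of eigenvalues; the geometric multiplicity of an eigenvalue $\lambda$ of $H^*$ is $\dim\ker(H^*-\lambda)$. *)

(* Defs.v *)
From HB Require Import structures.
From mathcomp Require Import all_boot all_order all_algebra.
From mathcomp Require Import all_classical all_reals all_analysis.
From mathcomp Require Import complex.
Set Implicit Arguments.
Unset Strict Implicit.
Unset Printing Implicit Defensive.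
Import Order.TTheory GRing.Theory Num.Theory.
Import numFieldNormedType.Exports.
Local Open Scope classical_set_scope.
Local Open Scope ring_scope.
Local Open Scope complex_scope.

(* Elements of L^2(Omega) are represented by functions R -> R[i]; their values
   outside Omega are irrelevant, and every notion below is invariant under
   equality almost everywhere on Omega of Borel measurable functions. *)
Section L2.
Context {R : realType}.
Implicit Types (Omega : set R) (f g : R -> R[i]).

Definition eq_ae Omega f g : Prop :=
  ae_eq (@lebesgue_measure R) Omega f g.

(* Only applied to integrable functions below: products of two L^2 functions,
   or of an L^2 function and a bounded one on the bounded interval I0. *)
Definition Cintegral Omega f : R[i] :=
  (\int[lebesgue_measure]_(x in Omega) complex.Re (f x)) +i*
  (\int[lebesgue_measure]_(x in Omega) complex.Im (f x)).

Definition L2 Omega f : Prop :=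
  [/\ measurable_fun Omega (fun x => complex.Re (f x)),
      measurable_fun Omega (fun x => complex.Im (f x)) &
      lebesgue_measure.-integrable Omega
        (fun x => (complex.Re (f x) ^+ 2 + complex.Im (f x) ^+ 2)%:E)].

Definition inner Omega f g : R[i] := Cintegral Omega (fun x => f x * (g x)^*).

(* C_c^oo(Omega). Real-valued test functions suffice: both sides of
   [weak_derivative] are complex linear in the test function. *)
Definition test_function Omega (phi : R -> R) : Prop :=
  (forall n (x : R), derivable (derive1n n phi) x 1) /\
  (exists K : set R, [/\ compact K, K `<=` Omega &
                         forall x, ~ K x -> phi x = 0]).

Definition weak_derivative Omega (n : nat) f g : Prop :=
  forall phi : R -> R, test_function Omega phi ->
    Cintegral Omega (fun x => f x * (derive1n n phi x)%:C) =
    (-1) ^+ n * Cintegral Omega (fun x => g x * (phi x)%:C).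

(* The Sobolev space H^m = W^{m,2}. *)
Definition Sobolev Omega (m : nat) f : Prop :=
  L2 Omega f /\
  forall n, (n <= m)%N -> exists2 g, L2 Omega g & weak_derivative Omega n f g.

(* Linear independence in L^2(Omega), that is, modulo null functions. *)
Definition free_ae Omega n (e : n.-tuple (R -> R[i])) : Prop :=
  forall c : 'I_n -> R[i],
    eq_ae Omega (fun x => \sum_(i < n) c i * tnth e i x) (fun=> 0) ->
    forall i, c i = 0.

End L2.

(* A (possibly unbounded) operator in L^2(Omega) is given by its graph:
   [T psi eta] means that psi is in the domain of T and T psi = eta. *)
Section Operators.
Context {R : realType}.
Implicit Types (Omega : set R) (T : (R -> R[i]) -> (R -> R[i]) -> Prop).

(* For densely defined T the vector eta is determined up to equality a.e. *)
Definition adjoint Omega T (psi eta : R -> R[i]) : Prop :=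
  [/\ L2 Omega psi, L2 Omega eta &
      forall u v, T u v -> inner Omega v psi = inner Omega u eta].

(* psi \in ker (T - lam) *)
Definition eigenspace_of T (lam : R[i]) : set (R -> R[i]) :=
  [set psi | T psi (fun x => lam * psi x)].

Definition eigenfunction Omega T (lam : R[i]) (psi : R -> R[i]) : Prop :=
  eigenspace_of T lam psi /\ ~ eq_ae Omega psi (fun=> 0).

Definition point_spectrum Omega T : set R[i] :=
  [set lam | exists psi, eigenfunction Omega T lam psi].

(* dim ker (T - lam) = n *)
Definition geometric_multiplicity Omega T (lam : R[i]) (n : nat) : Prop :=
  exists e : n.-tuple (R -> R[i]),
    [/\ forall i, eigenspace_of T lam (tnth e i),
        free_ae Omega e &
        forall psi, eigenspace_of T lam psi ->
          exists c : 'I_n -> R[i],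
            eq_ae Omega psi (fun x => \sum_(i < n) c i * tnth e i x)].

(* psi is, up to a nonzero factor, the only eigenfunction for lam. *)
Definition the_eigenfunction Omega T (lam : R[i]) (psi : R -> R[i]) : Prop :=
  eigenfunction Omega T lam psi /\
  forall phi, eigenfunction Omega T lam phi ->
    exists2 c : R[i], c != 0 & eq_ae Omega phi (fun x => c * psi x).

End Operators.

Section Model.
Context {R : realType}.
Implicit Types (a k : R) (m : nat).

Definition I0 : set R := `](- (pi / 2)), (pi / 2)[.

(* u is the continuous representative of psi on [-pi/2, pi/2]. *)
Definition continuous_representative (psi u : R -> R[i]) : Prop :=
  [/\ {within `[(- (pi / 2)), (pi / 2)], continuous (fun x => complex.Re (u x))},
      {within `[(- (pi / 2)), (pi / 2)], continuous (fun x => complex.Im (u x))} &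
      eq_ae I0 psi u].

Definition dom_H a (psi : R -> R[i]) : Prop :=
  Sobolev I0 2 psi /\
  exists u, [/\ continuous_representative psi u,
                u (- (pi / 2)) = u (pi / 2 * a) &
                u (pi / 2 * a) = u (pi / 2)].

(* The graph of psi |-> - psi'' on dom_H. *)
Definition H a (psi eta : R -> R[i]) : Prop :=
  [/\ dom_H a psi, L2 I0 eta & weak_derivative I0 2 psi (fun x => - eta x)].

Definition freq_minus a m : R := (4 * m)%:R / (1 - a).
Definition freq_plus a m : R := (4 * m)%:R / (1 + a).
Definition freq_zero m : R := (2 * m)%:R.

Definition sigma_minus a : set R[i] :=
  [set lam | exists2 m, (0 < m)%N & lam = (freq_minus a m ^+ 2)%:C].
Definition sigma_plus a : set R[i] :=
  [set lam | exists2 m, (0 < m)%N & lam = (freq_plus a m ^+ 2)%:C].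
Definition sigma_zero : set R[i] :=
  [set lam | exists m, lam = (freq_zero m ^+ 2)%:C].

(* The column (f, g): f on the left of pi a / 2 and g on its right. *)
Definition piecewise a (f g : R -> R) (x : R) : R[i] :=
  (if x < pi / 2 * a then f x else g x)%:C.

Definition phi_right a k : R -> R[i] :=
  piecewise a (fun=> 0) (fun x => sin (k * (x - pi / 2))).
Definition phi_left a k : R -> R[i] :=
  piecewise a (fun x => sin (k * (x + pi / 2))) (fun=> 0).
Definition phi_both a k : R -> R[i] :=
  piecewise a (fun x => sin (k * (x + pi / 2))) (fun x => sin (k * (x - pi / 2))).
Definition phi_affine a : R -> R[i] :=
  piecewise a (fun x => (a - 1) * (x + pi / 2)) (fun x => (a + 1) * (x - pi / 2)).

End Model.

(* Main.v *)
(* Put p = - pi / 2, c = pi a / 2 and r = pi / 2. Two applications of the lemma of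
   du Bois-Reymond show that H u = v iff u = A + B (x - p) - \int_p \int_p v, where
   B (c - p) and B (r - p) are the values of the double primitive at c and r. Hence v
   is in the range of H iff it is orthogonal to the continuous piecewise affine
   function which vanishes at p and r and has its corner at c. Testing an element psi
   of ker (H* - lam) against all such pairs (u, v), and against u = 1, v = 0, shows
   that psi solves - psi'' = lam psi on both sides of c, is continuous, vanishes at p
   and r, and has lam \int psi = 0; conversely these conditions suffice.

   For lam = k^2 <> 0 this gives psi = A sin (k (x - p)) on the left of c and
   psi = B sin (k (x - r)) on its right. With s_i, c_i the sine and the cosine of
   k (c - p) / 2 and k (r - c) / 2, continuity and mean zero become
   A s_1 c_1 = - B s_2 c_2 and A s_1^2 = B s_2^2. A nonzero solution (A, B) forces
   s_1 = 0, s_2 = 0 or s_1 c_2 + c_1 s_2 = sin (k pi / 2) = 0; since the complex sine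
   only has real zeros, k is real. The three cases are the three families of
   eigenvalues, and (A, B) is unique up to a factor unless s_1 = s_2 = 0. *)

Require Import Defs.
From HB Require Import structures.
From mathcomp Require Import all_boot all_order all_algebra.
From mathcomp Require Import all_classical all_reals all_analysis.
From mathcomp Require Import measurable_realfun complex ring lra.
Set Implicit Arguments.
Unset Strict Implicit.
Unset Printing Implicit Defensive.
Import Order.TTheory GRing.Theory Num.Theory.
Import numFieldNormedType.Exports.
Local Open Scope classical_set_scope.
Local Open Scope ring_scope.

(** * Integration on a segment *)

(** Reality of the eigenvalues cannot be taken from symmetry of [H], so [lam] stays complex until
    the zeros of the complex sine settle the matter. Real pairs [(u, v)] nevertheless suffice as
    test data: pairing with them separates the real and imaginary parts of [psi], and only the
    factor [lam] couples the two.

    An element of the kernel is merely square integrable, so its regularity must come out of the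
    pairing. Integrations by parts put all primitives on [lam psi], and the pairing becomes: a
    certain function [F] is orthogonal to every [v] that is orthogonal to [corner]. Subtracting from
    [F] its projection on [corner] leaves a vector orthogonal to itself, so [F] is a multiple of
    [corner]; this multiple is, up to the factor [r - p], the jump of the derivative of [psi] at
    [c].

    Mean zero enters as a condition on derivatives: the primitive of [lam psi] vanishes at both
    ends, so the derivative of [psi] changes by the same amount from [p] to [c] as from [r] back to
    [c]. This gives a relation between values of [cos - 1], whence the half angles. *)

Module Segment.

Section Primitive.
Context {R : realType} (p r : R).
Hypothesis pr : p < r.
Local Notation mu := (@lebesgue_measure R).
Implicit Types (f g h F : R -> R) (x c d : R).

Definition integ f : Prop := mu.-integrable `[p, r] (EFin \o f).
Definition cont f : Prop := {within `[p, r], continuous f}.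
Definition prim f x : R := \int[mu]_(t in `[p, x]) f t.
Definition total f : R := prim f r.
(** Stated on the open interval, as [I0] is, while [prim] integrates over closed ones; [eqae_closed]
    bridges the two because endpoints are null sets. *)
Definition eqae f g : Prop := ae_eq mu [set` `]p, r[] f g.

Lemma integ_cont f : cont f -> integ f.
Proof.
by move=> cf; apply: continuous_compact_integrable => //; exact: segment_compact.
Qed.

Lemma cont_cst c : cont (fun=> c).
Proof. by move=> x; exact: cvg_cst. Qed.

Lemma cont_continuous f : continuous f -> cont f.
Proof. exact: continuous_subspaceT. Qed.

Lemma contD f g : cont f -> cont g -> cont (fun x => f x + g x).
Proof. by move=> cf cg x; apply: cvgD; [exact: cf|exact: cg]. Qed.

Lemma contM f g : cont f -> cont g -> cont (fun x => f x * g x).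
Proof. by move=> cf cg x; apply: cvgM; [exact: cf|exact: cg]. Qed.

Lemma contB f g : cont f -> cont g -> cont (fun x => f x - g x).
Proof. by move=> cf cg x; apply: cvgB; [exact: cf|exact: cg]. Qed.

Lemma contZ c f : cont f -> cont (fun x => c * f x).
Proof. by move=> cf; apply: contM => //; exact: cont_cst. Qed.

Lemma integ_cst c : integ (fun=> c).
Proof. exact/integ_cont/cont_cst. Qed.

Lemma integD f g : integ f -> integ g -> integ (fun x => f x + g x).
Proof. exact: integrableD. Qed.

Lemma integB f g : integ f -> integ g -> integ (fun x => f x - g x).
Proof. exact: integrableB. Qed.

Lemma integZ c f : integ f -> integ (fun x => c * f x).
Proof. exact: integrableZl. Qed.

Lemma cont_bounded f : cont f -> [bounded f x | x in `[p, r]].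
Proof.
move=> cf; have /compact_bounded[M [_ mrt]] := continuous_compact cf (@segment_compact _ p r).
by exists M; split; rewrite ?num_real // => ? ? ? ?; exact: mrt.
Qed.

Lemma cont_measurable f : cont f -> measurable_fun `[p, r] f.
Proof. by move=> cf; exact: subspace_continuous_measurable_fun. Qed.

Lemma integM f g : integ f -> cont g -> integ (fun x => f x * g x).
Proof.
move=> fi gc; rewrite /integ (_ : _ \o _ = ((EFin \o f) \* (EFin \o g))%E); last first.
  by apply/funext => x /=; rewrite EFinM.
by apply: integrableMl => //; [exact: cont_measurable|exact: cont_bounded].
Qed.

Lemma integS f x : p <= x <= r -> integ f -> mu.-integrable `[p, x] (EFin \o f).
Proof.
move=> /andP[px xr]; apply: integrableS => //.
by apply: subset_itvl; rewrite bnd_simp.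
Qed.

Lemma primD f g x : p <= x <= r -> integ f -> integ g ->
  prim (fun t => f t + g t) x = prim f x + prim g x.
Proof. by move=> xI fi gi; rewrite /prim RintegralD//; exact: integS. Qed.

Lemma primB f g x : p <= x <= r -> integ f -> integ g ->
  prim (fun t => f t - g t) x = prim f x - prim g x.
Proof. by move=> xI fi gi; rewrite /prim RintegralB//; exact: integS. Qed.

Lemma primZ c f x : p <= x <= r -> integ f ->
  prim (fun t => c * f t) x = c * prim f x.
Proof. by move=> xI fi; rewrite /prim RintegralZl//; exact: integS. Qed.

Lemma prim0 f : prim f p = 0.
Proof. by rewrite /prim set_itv1 Rintegral_set1. Qed.

Lemma primE f g x : p <= x <= r -> (forall t, p <= t <= r -> f t = g t) ->
  prim f x = prim g x.
Proof.
move=> /andP[px xr] fg; apply: eq_Rintegral => t; rewrite inE /= in_itv /= => /andP[pt tx].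
by apply: fg; rewrite pt (le_trans tx).
Qed.

Lemma prim_cst c x : p <= x -> prim (fun=> c) x = c * (x - p).
Proof.
move=> px; rewrite /prim Rintegral_cst//.
congr (_ * _).
rewrite (congr1 fine (lebesgue_measure_itv `[p, x])) /= lte_fin.
by case: ltgtP px => // -> _; rewrite subrr.
Qed.

Lemma prim_cont f : integ f -> cont (prim f).
Proof. by move=> fi; apply: parameterized_integral_continuous => //; exact: ltW. Qed.

Lemma ae_neq c : \forall x \ae mu, x <> c.
Proof.
exists [set c]; split; [by []|exact: lebesgue_measure_set1|].
by move=> x /=; apply: contrapT.
Qed.

Lemma eqae_closed f g : eqae f g -> ae_eq mu [set` `[p, r]] f g.
Proof.
move=> fg; apply: filterS3 fg (ae_neq p) (ae_neq r) => x fg /eqP xp /eqP xr.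
rewrite /= in_itv /= => /andP[px rx]; apply: fg.
by rewrite /= in_itv /= !lt_neqAle px rx xr eq_sym xp.
Qed.

Lemma eqae_prim f g x : p <= x <= r -> integ f -> integ g -> eqae f g ->
  prim f x = prim g x.
Proof.
move=> xI fi gi /eqae_closed fg; rewrite /prim /Rintegral; congr fine.
apply: ae_eq_integral => //.
- by have /measurable_int := integS xI fi.
- by have /measurable_int := integS xI gi.
- apply: filterS fg => t /= + ptx; rewrite in_itv/=.
  move: ptx; rewrite /= in_itv /= => /andP[pt tx] E; congr EFin; apply: E.
  by rewrite pt (le_trans tx)//; case/andP: xI.
Qed.

Lemma prim_tail f x : p <= x <= r -> integ f ->
  \int[mu]_(t in `[x, r]) f t = total f - prim f x.
Proof.
move=> /andP[px xr] fi; rewrite /total /prim Rintegral_itvB// ?bnd_simp//.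
rewrite Rintegral_itv_obnd_cbnd//.
apply: integrableS fi => //; apply: subset_itvr; by rewrite bnd_simp.
Qed.

(* Fubini on the triangle x <= y. *)
Lemma prim_by_parts f g : integ f -> integ g ->
  total (fun x => prim f x * g x) =
  total f * total g - total (fun x => f x * prim g x).
Proof.
move=> fi gi.
have pi : p <= r <= r by rewrite (ltW pr) lexx.
(* Extension by zero turns the iterated integrals into integrals over the line; the last factor of
   [K] cuts out the triangle. *)
pose f' := f \_ `[p, r]; pose g' := g \_ `[p, r].
have f'i : mu.-integrable setT (EFin \o f').
  by rewrite -restrict_EFin; apply/integrable_restrict => //=; rewrite setTI.
have g'i : mu.-integrable setT (EFin \o g').
  by rewrite -restrict_EFin; apply/integrable_restrict => //=; rewrite setTI.
have mf' : measurable_fun setT f' by have /measurable_int/measurable_EFinP := f'i.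
have mg' : measurable_fun setT g' by have /measurable_int/measurable_EFinP := g'i.
pose K (z : R * R) : R := f' z.1 * g' z.2 * (z.1 <= z.2)%R%:R.
have mK : measurable_fun setT K.
  apply: measurable_funM.
    by apply: measurable_funM; apply: measurableT_comp.
  apply: measurableT_comp; first by [].
  by apply: measurable_fun_ler.
(* By Tonelli the integral of the absolute value is a product of two finite integrals; this function
   then dominates [K]. *)
have HI : (mu \x mu)%E.-integrable setT (fun z : R * R => (f' z.1 * g' z.2)%:E).
  have mH : measurable_fun setT (fun z : R * R => (f' z.1 * g' z.2)%:E).
    by apply/measurable_EFinP; apply: measurable_funM; apply: measurableT_comp.
  have [_] := (@integrable12ltyP _ _ _ _ _ mu mu _ mH); apply; rewrite /=.
  have /integrableP[_ f'oo] := f'i; have /integrableP[_ g'oo] := g'i.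
  have -> : (\int[mu]_x \int[mu]_y `|f' x * g' y|%:E =
      \int[mu]_x ((\int[mu]_y `|(g' y)%:E|) * `|(f' x)%:E|))%E.
    apply: eq_integral => x _; rewrite -ge0_integralZr//; last first.
      by apply: measurableT_comp => //; exact/measurable_EFinP.
    by apply: eq_integral => y _; rewrite -abseM -EFinM mulrC.
  rewrite ge0_integralZl//; last 2 first.
  - by apply: measurableT_comp => //; exact/measurable_EFinP.
  - exact: integral_ge0.
  by rewrite lte_mul_pinfty ?ge0_fin_numE ?integral_ge0.
have KI : (mu \x mu)%E.-integrable setT (EFin \o K).
  apply: le_integrable HI => //; first exact/measurable_EFinP.
  move=> z _; rewrite /= lee_fin /K normrM; case: (z.1 <= z.2) => /=.
    by rewrite normr1 mulr1.
  by rewrite normr0 mulr0.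
have := Fubini KI; rewrite /K /=.
rewrite (_ : (\int[mu]_x \int[mu]_y (f' x * g' y * (x <= y)%R%:R)%:E)%E =
   (\int[mu]_(x in `[p, r]) (f x * (total g - prim g x))%:E)%E); last first.
  rewrite [RHS]integral_mkcond; apply: eq_integral => x _; rewrite !patchE.
  case: ifPn => [|xI]; last by rewrite integral0_eq// => y _; rewrite /f' patchE (negbTE xI) !mul0r.
  rewrite inE /= in_itv /= => xI.
  rewrite -prim_tail// /Rintegral EFinM fineK; last first.
    apply: integrable_fin_num => //; apply: integrableS gi => //.
    by apply: subset_itvr; rewrite bnd_simp; case/andP: xI.
  rewrite -integralZl//; last first.
    apply: integrableS gi => //.
    by apply: subset_itvr; rewrite bnd_simp; case/andP: xI.
  rewrite [RHS]integral_mkcond; apply: eq_integral => y _; rewrite /f' /g' !patchE.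
  rewrite mem_set; last by rewrite /= in_itv.
  case: ifPn; rewrite ?notin_setE ?inE /= !in_itv /= => yI.
    case/andP: yI => py yr; rewrite [y \in _](_ : _ = (x <= y)).
      by case: (x <= y); rewrite ?mulr1 ?mulr0.
    by apply/idP/idP; rewrite inE /= in_itv /= ?yr ?andbT.
  rewrite memNset /= ?in_itv /=; last first.
    by move=> /andP[xy yr]; apply: yI; rewrite yr andbT (le_trans _ xy)//; case/andP: xI.
  by rewrite [f x * _]mulr0 mul0r.
rewrite (_ : (\int[mu]_y \int[mu]_x (f' x * g' y * (x <= y)%R%:R)%:E)%E =
   (\int[mu]_(y in `[p, r]) (prim f y * g y)%:E)%E); last first.
  rewrite [RHS]integral_mkcond; apply: eq_integral => y _; rewrite !patchE.
  case: ifPn => [|yI]; last by rewrite integral0_eq// => x _; rewrite /g' patchE (negbTE yI) !mulr0 mul0r.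
  rewrite inE /= in_itv /= => yI.
  rewrite /prim /Rintegral EFinM fineK; last first.
    by apply: integrable_fin_num => //; exact: integS.
  rewrite -integralZr//; last exact: integS.
  rewrite [RHS]integral_mkcond; apply: eq_integral => x _; rewrite /f' /g' !patchE.
  rewrite (@mem_set _ _ y); last by rewrite /= in_itv.
  case: ifPn; rewrite ?notin_setE ?inE /= !in_itv /= => xI.
    case/andP: xI => px xr; rewrite [x \in _](_ : _ = (x <= y)).
      by case: (x <= y); rewrite ?mulr1 ?mulr0.
    by apply/idP/idP; rewrite inE /= in_itv /= ?px.
  rewrite memNset /= ?in_itv /=; last first.
    by move=> /andP[px xy]; apply: xI; rewrite px (le_trans xy)//; case/andP: yI.
  by rewrite [_ * g y]mul0r mul0r.
move/(congr1 fine); rewrite -/(Rintegral _ _ _) -/(Rintegral _ _ _).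
move=> E; transitivity (prim (fun x => f x * (total g - prim g x)) r).
  exact: esym E.
rewrite (@primE _ (fun x => total g * f x - f x * prim g x)) //; last first.
  by move=> t _; ring.
rewrite primB//; last 2 first.
- exact: integZ.
- by apply: integM => //; exact: prim_cont.
by rewrite primZ// mulrC.
Qed.

Lemma totalB f g : integ f -> integ g ->
  total (fun x => f x - g x) = total f - total g.
Proof. by move=> fi gi; rewrite /total primB// lexx ltW. Qed.

Lemma totalD f g : integ f -> integ g ->
  total (fun x => f x + g x) = total f + total g.
Proof. by move=> fi gi; rewrite /total primD// lexx ltW. Qed.

Lemma totalZ c f : integ f -> total (fun x => c * f x) = c * total f.
Proof. by move=> fi; rewrite /total primZ// lexx ltW. Qed.

Lemma totalE f g : (forall t, p <= t <= r -> f t = g t) -> total f = total g.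
Proof. by move=> fg; rewrite /total (primE _ fg)// lexx ltW. Qed.

Lemma eqae_total f g : integ f -> integ g -> eqae f g -> total f = total g.
Proof. by move=> fi gi fg; rewrite /total (eqae_prim _ fi gi fg)// lexx ltW. Qed.

Lemma cont_in f x : cont f -> p < x < r -> {for x, continuous f}.
Proof.
by move=> cf xI; have [+ _ _] := (continuous_within_itvP f pr).1 cf; apply; rewrite in_itv.
Qed.

Lemma prim_derive f x : cont f -> p < x < r -> is_derive x 1 (prim f) (f x).
Proof.
move=> cf /andP[px xr].
have fx : {for x, continuous f} by apply: cont_in; rewrite ?px.
have [] := continuous_FTC1_closed xr (integ_cont cf) px fx.
by move=> d <-; rewrite derive1E; exact: derivableP.
Qed.

Definition sqint f : Prop :=
  measurable_fun `[p, r] f /\ integ (fun x => f x ^+ 2).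

(** Domination by [f^2 + g^2], from the square of [|f| - |g|]. *)
Lemma sqintM f g : sqint f -> sqint g -> integ (fun x => f x * g x).
Proof.
move=> [mf fi] [mg gi].
apply: le_integrable (integD fi gi) => //.
  by apply/measurable_EFinP; exact: measurable_funM.
move=> x _ /=; rewrite lee_fin normrM (ger0_norm (addr_ge0 (sqr_ge0 _) (sqr_ge0 _))).
rewrite -(real_normK (num_real (f x))) -(real_normK (num_real (g x))).
have := sqr_ge0 (`|f x| - `|g x|); have := normr_ge0 (f x); have := normr_ge0 (g x); nra.
Qed.

Lemma cont_sqint f : cont f -> sqint f.
Proof.
move=> cf; split; first exact: cont_measurable.
by apply: integ_cont; apply: contM.
Qed.

Lemma sqint_integ f : sqint f -> integ f.
Proof.
move=> fi; have := sqintM fi (cont_sqint (@cont_cst 1)).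
by rewrite /integ (_ : (fun x => _) = f) //; apply/funext => x; rewrite mulr1.
Qed.

Lemma sqintD f g : sqint f -> sqint g -> sqint (fun x => f x + g x).
Proof.
move=> /[dup] fs [mf fi] /[dup] gs [mg gi]; split; first exact: measurable_funD.
have := integD (integD fi gi) (integZ 2 (sqintM fs gs)).
rewrite /integ; apply: eq_ind; congr (_.-integrable _ _); apply/funext => x /=.
by congr (_%:E); ring.
Qed.

Lemma sqintZ c f : sqint f -> sqint (fun x => c * f x).
Proof.
move=> [mf fi]; split; first by apply: measurable_funM => //; exact: measurable_cst.
have := integZ (c ^+ 2) fi.
rewrite /integ; apply: eq_ind; congr (_.-integrable _ _); apply/funext => x /=.
by congr (_%:E); ring.
Qed.

Lemma sqintB f g : sqint f -> sqint g -> sqint (fun x => f x - g x).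
Proof.
move=> fs gs; have := sqintD fs (sqintZ (-1) gs).
by rewrite (_ : (fun x => _) = (fun x => f x - g x)) //; apply/funext => x; ring.
Qed.

End Primitive.

Section Primitive2.
Context {R : realType}.
Local Notation mu := (@lebesgue_measure R).
Implicit Types (f g h F : R -> R) (p r x c d : R).

Lemma prim_split p c x f : p <= c <= x -> integ p x f ->
  prim p f x = prim p f c + prim c f x.
Proof.
move=> cI fi; have := prim_tail cI fi; rewrite /total /prim => ->; by rewrite subrKC.
Qed.

Lemma contS p r c d f : p <= c -> d <= r -> cont p r f -> cont c d f.
Proof.
move=> pc dr; apply: continuous_subspaceW; apply: subset_itv; by rewrite bnd_simp.
Qed.

Lemma integSS p r c d f : p <= c -> d <= r -> integ p r f -> integ c d f.
Proof.
move=> pc dr; apply: integrableS => //; apply: subset_itv; by rewrite bnd_simp.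
Qed.

Lemma prim_FTC p r f F : p <= r -> cont p r f -> cont p r F ->
  (forall x, p < x < r -> is_derive x 1 F (f x)) ->
  prim p f r = F r - F p.
Proof.
rewrite le_eqVlt => /predU1P[-> _ _ _|pr cf cF dF]; first by rewrite prim0 subrr.
have [cF1 cF2 cF3] := (continuous_within_itvP F pr).1 cF.
rewrite /prim /Rintegral (continuous_FTC2 (F := F) pr cf)//.
- split => // x; rewrite in_itv /= => xI.
  by case: (dF _ xI).
- move=> x; rewrite in_itv /= => xI; have := dF _ xI.
  by move=> dx; rewrite derive1E derive_val.
Qed.

End Primitive2.

End Segment.
Import Segment.

(** * Smooth functions *)

Section Derivatives.
Context {R : realType}.
Implicit Types (f g : R -> R) (x a b c : R).

Lemma derD f g x a b : is_derive x 1 f a -> is_derive x 1 g b ->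
  is_derive x 1 (fun t => f t + g t) (a + b).
Proof. exact: is_deriveD. Qed.

Lemma derB f g x a b : is_derive x 1 f a -> is_derive x 1 g b ->
  is_derive x 1 (fun t => f t - g t) (a - b).
Proof. exact: is_deriveB. Qed.

Lemma derZ c f x a : is_derive x 1 f a -> is_derive x 1 (fun t => c * f t) (c * a).
Proof. exact: is_deriveZ. Qed.

Lemma derM f g x a b : is_derive x 1 f a -> is_derive x 1 g b ->
  is_derive x 1 (fun t => f t * g t) (a * g x + f x * b).
Proof.
by move=> fa gb; have := is_deriveM fa gb; rewrite addrC [g x *: a]mulrC.
Qed.

Lemma der_cst c x : is_derive x 1 (fun=> c) 0.
Proof. exact: is_derive_cst. Qed.

Lemma der_aff c b x : is_derive x 1 (fun t => c * (t + b)) c.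
Proof.
have := derZ c (derD (is_derive_id x 1) (der_cst b x)).
by rewrite addr0 mulr1.
Qed.

Lemma der_comp f g x a b : is_derive (g x) 1 f a -> is_derive x 1 g b ->
  is_derive x 1 (fun t => f (g t)) (a * b).
Proof. exact: is_derive1_comp. Qed.

Lemma der_comp_aff f c b x a : is_derive (c * (x + b)) 1 f a ->
  is_derive x 1 (fun t => f (c * (t + b))) (c * a).
Proof.
by move=> fa; have := @der_comp f (fun t => c * (t + b)) x a c fa (der_aff c b x); rewrite mulrC.
Qed.

Lemma der_continuous f x a : is_derive x 1 f a -> {for x, continuous f}.
Proof.
by move=> [/derivable1_diffP/differentiable_continuous].
Qed.

Lemma der_derive1 f g : (forall x, is_derive x 1 f (g x)) -> (derive1 f) = g.
Proof. by move=> fg; apply/funext => x; rewrite derive1E; have := fg x => ?; rewrite derive_val. Qed.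

Lemma derivable_der f x : derivable f x 1 -> is_derive x 1 f ((derive1 f) x).
Proof. by move=> d; rewrite derive1E; exact: derivableP. Qed.

Definition smooth f := forall n x, derivable (derive1n n f) x 1.

(** An order [n] means that [n + 1] derivatives exist everywhere. Each derivative is an explicit
    witness, so closure under sums, products and affine substitutions is a plain induction, without
    a Leibniz formula for iterated derivatives. *)
Inductive smooth_upto : nat -> (R -> R) -> Prop :=
| smooth_upto0 f f' : (forall x, is_derive x 1 f (f' x)) -> smooth_upto 0 f
| smooth_uptoS n f f' : (forall x, is_derive x 1 f (f' x)) ->
    smooth_upto n f' -> smooth_upto n.+1 f.

Lemma smooth_uptoP f : (forall n, smooth_upto n f) -> smooth f.
Proof.
move=> h n; have {h} := h n; elim => {n f} [f f' df x|n f f' df _ IH].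
  by case: (df x).
by move=> x; rewrite derive1Sn (der_derive1 df); exact: IH.
Qed.

Lemma smooth_upto_pred n f : smooth_upto n.+1 f -> smooth_upto n f.
Proof.
elim: n f => [|n IH] f h; inversion_clear h.
  exact: smooth_upto0 H.
by apply: smooth_uptoS H _; exact: IH.
Qed.

Lemma smooth_uptoD n f g : smooth_upto n f -> smooth_upto n g ->
  smooth_upto n (fun x => f x + g x).
Proof.
elim: n f g => [|n IH] f g sf sg; inversion_clear sf as [? f' df|? ? f' df sf'];
  inversion_clear sg as [? g' dg|? ? g' dg sg'].
  exact: (smooth_upto0 (fun x => derD (df x) (dg x))).
exact: (smooth_uptoS (fun x => derD (df x) (dg x)) (IH _ _ sf' sg')).
Qed.

Lemma smooth_uptoM n f g : smooth_upto n f -> smooth_upto n g ->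
  smooth_upto n (fun x => f x * g x).
Proof.
(* The product rule multiplies a derivative by an undifferentiated factor of higher order; the
   copies [sf1] and [sg1] are kept to lower that order. *)
elim: n f g => [|n IH] f g /[dup] sf1 sf /[dup] sg1 sg;
  inversion_clear sf as [? f' df|? ? f' df sf'];
  inversion_clear sg as [? g' dg|? ? g' dg sg'].
  exact: (smooth_upto0 (fun x => derM (df x) (dg x))).
apply: (smooth_uptoS (fun x => derM (df x) (dg x))).
exact: smooth_uptoD (IH _ _ sf' (smooth_upto_pred sg1)) (IH _ _ (smooth_upto_pred sf1) sg').
Qed.

Lemma smooth_upto_cst n c : smooth_upto n (fun=> c).
Proof.
elim: n c => [|n IH] c; first exact: (smooth_upto0 (der_cst c)).
exact: (smooth_uptoS (der_cst c) (IH 0)).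
Qed.

Lemma smooth_upto_aff n f c b : smooth_upto n f ->
  smooth_upto n (fun x => f (c * (x + b))).
Proof.
elim: n f => [|n IH] f sf; inversion_clear sf as [? f' df|? ? f' df sf'].
  exact: (smooth_upto0 (fun x => der_comp_aff (df (c * (x + b))))).
apply: (smooth_uptoS (fun x => der_comp_aff (df (c * (x + b))))).
exact: smooth_uptoM (smooth_upto_cst n c) (IH _ sf').
Qed.

(* All one-sided derivatives at 0 vanish; the powers of x^-1 make the family
   stable under differentiation up to linear combinations. *)
Definition flat (k : nat) x : R := if 0 < x then x^-1 ^+ k * expR (- x^-1) else 0.

(** With [y = 1/x], the bound [expR y >= y^(k+1) / (k+1)!] gives [y^k expR (-y) <= (k+1)! / y].
    Being linear in [x], it yields continuity at 0 for every [k] at once. *)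
Lemma flat_bound k x : `|flat k x| <= (k.+1)`!%:R * `|x|.
Proof.
rewrite /flat; case: ifPn => x0; last by rewrite normr0 mulr_ge0.
rewrite (gtr0_norm x0) ger0_norm; last first.
  by rewrite mulr_ge0 ?expR_ge0// exprn_ge0// invr_ge0 ltW.
have y0 : 0 <= x^-1 by rewrite invr_ge0 ltW.
rewrite expRN ler_pdivrMr ?expR_gt0//.
have := @expR_ge1Dxn _ _ k y0.
have f0 : 0 < (k.+1)`!%:R :> R by rewrite ltr0n fact_gt0.
move=> h; have {h} : x^-1 ^+ k.+1 / (k.+1)`!%:R <= expR x^-1 by lra.
rewrite ler_pdivrMr// exprSr => h.
rewrite -(ler_pM2r (_ : 0 < x^-1)) ?invr_gt0//.
rewrite (le_trans h)// (_ : _ / x = (k.+1)`!%:R * expR x^-1) 1?mulrC//.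
by field; rewrite gt_eqF.
Qed.

Lemma flat_continuous0 k : {for 0, continuous (flat k)}.
Proof.
have f00 : flat k 0 = 0 by rewrite /flat ltxx.
rewrite /prop_for /continuous_at f00.
apply: (@squeeze_cvgr _ (nbhs (0 : R)) _ _ (fun x => - ((k.+1)`!%:R * `|x|)) (fun x => (k.+1)`!%:R * `|x|)).
- by near=> x; rewrite -ler_norml flat_bound.
- rewrite -[X in _ --> X]oppr0; apply: cvgN.
  rewrite -[X in _ --> X](mulr0 (k.+1)`!%:R); apply: cvgMr.
  by rewrite -[X in _ --> X](@normr0 _ R); exact: norm_continuous.
- rewrite -[X in _ --> X](mulr0 (k.+1)`!%:R); apply: cvgMr.
  by rewrite -[X in _ --> X](@normr0 _ R); exact: norm_continuous.
Unshelve. all: by end_near. Qed.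

Lemma flat_der k x : is_derive x 1 (flat k) (flat k.+2 x - k%:R * flat k.+1 x).
Proof.
have [x0|x0|->] := ltgtP x 0.
- rewrite {2 3}/flat ltNge (ltW x0) /= mulr0 subr0.
  apply: (@near_eq_is_derive _ _ _ (fun=> 0)).
  near=> y; rewrite /flat ltNge ifF //; apply/negbTE; rewrite negbK ltW //.
  by near: y; exact: lt_nbhsl.
- have dV := is_deriveV (lt0r_neq0 x0) (is_derive_id x (1 : R)).
  have dE := @der_comp expR (fun y => - y^-1) x _ _ (is_derive_expR (- x^-1)) (is_deriveN dV).
  have dX : is_derive x 1 (fun y => y^-1 ^+ k) ((k%:R * x^-1 ^+ k.-1) * (- x ^- 2)) .
    have := is_deriveX k dV; rewrite [(- x ^- 2) *: _]mulr1.
    by rewrite (_ : _ ^+ k = (fun y => y^-1 ^+ k)) //; apply/funext => y; rewrite fctE.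
  have dF := derM dX dE.
  apply: is_derive_eq.
    apply: near_eq_is_derive dF; near=> y; rewrite /flat ifT //.
    by near: y; exact: lt_nbhsr.
  rewrite /flat x0 /= /GRing.scale /=.
  rewrite -exprVn; move: (x^-1) (expR _) => y E; rewrite mulr1.
  case: k {dX dF} => [|k] /=; first by rewrite !mul0r; ring.
  by rewrite !(exprS y k.+1) !exprS; ring.
- rewrite /flat ltxx mulr0 subr0 -/(flat k).
  (* At 0 the difference quotient of [flat k] is [flat k.+1], which is continuous there and
     vanishes. *)
  apply/is_derive1_caratheodory; exists (flat k.+1); split.
  + move=> z; rewrite /flat ltxx !subr0; case: ifPn => z0; last by rewrite mul0r.
    by rewrite exprS; field; rewrite gt_eqF.
  + exact: flat_continuous0.
  + by rewrite /flat ltxx.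
Unshelve. all: by end_near. Qed.

Lemma smooth_upto_flat n k : smooth_upto n (flat k).
Proof.
elim: n k => [|n IH] k; first exact: (smooth_upto0 (flat_der k)).
apply: (smooth_uptoS (flat_der k)).
rewrite (_ : (fun x => _) = (fun x => flat k.+2 x + (- k%:R) * flat k.+1 x)); last first.
  by apply/funext => x; rewrite mulNr.
by apply: smooth_uptoD => //; apply: smooth_uptoM => //; exact: smooth_upto_cst.
Qed.

(* Smooth, supported on ]s, t[, and increasing to its indicator as m grows. *)
Definition bump (s t : R) (m : nat) x : R :=
  flat 0 (m.+1%:R * (x + - s)) * flat 0 (- m.+1%:R * (x + - t)).

Lemma bump_smooth s t m : smooth (bump s t m).
Proof.
by apply: smooth_uptoP => n; apply: smooth_uptoM; apply: smooth_upto_aff; exact: smooth_upto_flat.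
Qed.

Lemma flat_ge0 k x : 0 <= flat k x.
Proof.
rewrite /flat; case: ifPn => // x0.
by rewrite mulr_ge0 ?expR_ge0// exprn_ge0// invr_ge0 ltW.
Qed.

Lemma flat0_le1 x : flat 0 x <= 1.
Proof.
by rewrite /flat; case: ifPn => // x0; rewrite expr0 mul1r -expR0 ler_expR oppr_le0 invr_ge0 ltW.
Qed.

Lemma bump_ge0 s t m x : 0 <= bump s t m x.
Proof. by rewrite mulr_ge0 ?flat_ge0. Qed.

Lemma bump_le1 s t m x : bump s t m x <= 1.
Proof. by rewrite mulr_ile1 ?flat_ge0 ?flat0_le1. Qed.

Lemma bump_out s t m x : ~~ (s < x < t) -> bump s t m x = 0.
Proof.
rewrite negb_and -!leNgt => /orP[h|h]; rewrite /bump /flat.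
  by rewrite pmulr_rgt0// subr_gt0 ltNge h mul0r.
by rewrite mulNr oppr_gt0 pmulr_rlt0// subr_lt0 [x < t]ltNge h mulr0.
Qed.

Lemma flat0_cvg x : 0 < x -> flat 0 (m.+1%:R * x) @[m --> \oo] --> (1 : R).
Proof.
move=> x0.
rewrite (_ : (fun m => _) = (fun m => expR (- (m.+1%:R^-1 * x^-1)))); last first.
  by apply/funext => m; rewrite /flat pmulr_rgt0// x0 expr0 mul1r invfM.
rewrite -[X in _ --> X](@expR0 R).
apply: continuous_cvg; first exact: continuous_expR.
rewrite -[X in _ --> X](oppr0); apply: cvgN.
rewrite -[X in _ --> X](mul0r x^-1); apply: cvgMl.
exact: cvg_harmonic.
Qed.

Lemma bump_cvg s t x : s < x < t -> bump s t m x @[m --> \oo] --> (1 : R).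
Proof.
move=> /andP[sx xt]; rewrite -[X in _ --> X](mulr1 1).
apply: cvgM; first by apply: flat0_cvg; rewrite subr_gt0.
rewrite (_ : (fun m => _) = (fun m => flat 0 (m.+1%:R * (t - x)))); last first.
  by apply/funext => m; congr flat; ring.
by apply: flat0_cvg; rewrite subr_gt0.
Qed.

End Derivatives.

(** * Weak derivatives *)

Section TestFunctions.
Context {R : realType} (p r : R).
Hypothesis pr : p < r.
Local Notation mu := (@lebesgue_measure R).
Local Notation integ := (integ p r).
Local Notation cont := (cont p r).
Local Notation prim := (prim p).
Local Notation total := (total p r).
Local Notation eqae := (eqae p r).
Local Notation test := (test_function (`]p, r[%classic : set R)).
Implicit Types (f g h F phi chi : R -> R) (x c d s t : R).

Lemma bump_test s t m : p < s -> t < r -> test (bump s t m).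
Proof.
move=> ps tr; split; first exact: bump_smooth.
exists `[s, t]%classic; split; first exact: segment_compact.
  by apply: subset_itv; rewrite bnd_simp.
move=> x /= /negP; rewrite in_itv /= => xI; apply: bump_out.
by apply: contra xI => /andP[sx xt]; rewrite !ltW.
Qed.

Lemma testP phi : test phi ->
  exists s t, [/\ p < s, s < t, t < r & forall x, ~~ (s <= x <= t) -> phi x = 0].
Proof.
move=> [_ [K [cK Kpr Kphi]]]; have [[k Kk]|K0] := pselect (K !=set0); last first.
  have pr' := pr; exists (p + (r - p) / 3), (p + (r - p) / 2); split; [lra|lra|lra|].
  by move=> x _; apply: Kphi => Kx; apply: K0; exists x.
have idc : {within K, continuous (id : R -> R)} by apply: continuous_subspaceT => y; exact: cvg_id.
have K0 : K !=set0 by exists k.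
have [s Ks sK] := compact_EVT_min K0 cK idc.
have [t Kt tK] := compact_EVT_max K0 cK idc.
have := Kpr _ (set_mem Ks); rewrite /= in_itv /= => /andP[ps sr].
have := Kpr _ (set_mem Kt); rewrite /= in_itv /= => /andP[pt tr].
(* The midpoint of [t] and [r] replaces the maximum [t] of the support, since [K] may be a single
   point and the interval must be nondegenerate. *)
exists s, ((t + r) / 2); split => //; last 2 first.
- lra.
- move=> x xst; apply: Kphi => Kx.
  have := sK _ (mem_set Kx); have := tK _ (mem_set Kx) => xt sx.
  by move/negP: xst; apply; rewrite sx (le_trans xt)//; lra.
- by have := sK _ Kt; lra.
Qed.

Lemma test_out phi x : test phi -> ~~ (p < x < r) -> phi x = 0.
Proof.
move=> /testP[s [t [ps st tr h]]] xpr; apply: h; apply: contra xpr => /andP[sx xt].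
by rewrite (lt_le_trans ps)// (le_lt_trans xt).
Qed.

Lemma test_der phi x : test phi -> is_derive x 1 phi (derive1 phi x).
Proof. by move=> [h _]; exact: derivable_der (h 0 x). Qed.

Lemma test_cont phi : test phi -> continuous phi.
Proof. by move=> tphi x; exact: der_continuous (test_der x tphi). Qed.

Lemma test_derive1 phi : test phi -> test (derive1 phi).
Proof.
move=> [sphi [K [cK Kpr Kphi]]]; split.
  by move=> n x; have := sphi n.+1 x; rewrite derive1Sn.
exists K; split => // x nKx.
have cl : closed K by apply: compact_closed => //; exact: Rhausdorff.
have : is_derive x 1 phi 0.
  apply: (@near_eq_is_derive _ _ _ (fun=> 0)).
  by near=> y; apply/esym/Kphi; near: y; exact: (open_nbhs_nbhs (conj (closed_openC cl) nKx)).
by move=> dx; rewrite derive1E derive_val.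
Unshelve. all: by end_near. Qed.

Lemma smooth_smooth_upto f n : smooth f -> smooth_upto n f.
Proof.
elim: n f => [|n IH] f sf.
  exact: (smooth_upto0 (fun x => derivable_der (sf 0%N x))).
apply: (smooth_uptoS (fun x => derivable_der (sf 0%N x))); apply: IH => m x.
by have := sf m.+1 x; rewrite derive1Sn.
Qed.

Lemma test_comb phi psi c : test phi -> test psi -> test (fun x => phi x - c * psi x).
Proof.
move=> [sphi [K [cK Kpr Kphi]]] [spsi [L [cL Lpr Lpsi]]]; split.
  apply: smooth_uptoP => n.
  rewrite (_ : (fun x => _) = (fun x => phi x + (- c) * psi x)); last first.
    by apply/funext => x; rewrite mulNr.
  apply: smooth_uptoD; first exact: (smooth_smooth_upto n sphi).
  apply: smooth_uptoM; first exact: smooth_upto_cst.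
  exact: smooth_smooth_upto.
exists (K `|` L); split; first exact: compactU.
  by move=> x [/Kpr|/Lpr].
move=> x /not_orP[nK nL]; by rewrite Kphi// Lpsi// mulr0 subrr.
Qed.

Lemma test_prim phi x : test phi -> p <= x <= r -> prim (derive1 phi) x = phi x.
Proof.
move=> tphi /andP[px xr].
have phip : phi p = 0 by rewrite (test_out tphi) ?ltxx.
rewrite -[RHS]subr0 -phip; apply: prim_FTC => //.
- by apply: cont_continuous; apply: test_cont; exact: test_derive1.
- by apply: cont_continuous; exact: test_cont.
- by move=> y _; exact: test_der.
Qed.

Lemma test_total phi : test phi -> total (derive1 phi) = 0.
Proof.
by move=> tphi; rewrite /total test_prim// ?(test_out tphi)// ?ltxx ?andbF// lexx ltW.
Qed.

(** Mean zero makes the primitive vanish to the right of the support as well. It starts at [-oo]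
    because a test function has to be smooth on the whole line. *)
Lemma test_antiderivative chi : test chi -> total chi = 0 ->
  exists2 phi, test phi & derive1 phi = chi.
Proof.
move=> tchi chi0.
have [s [t [ps st tr hst]]] := testP tchi.
pose phi x := (\int[mu]_(y in `]-oo, x]) chi y).
have chiR : chi = chi \_ `[p, r].
  apply/funext => x; rewrite patchE; case: ifPn => // /negP xpr.
  apply: (test_out tchi); apply: contra_notN xpr => /andP[px xr].
  by rewrite inE /= in_itv /= !ltW.
have ichi : mu.-integrable setT (EFin \o chi).
  rewrite chiR -restrict_EFin; apply/integrable_restrict => //=; rewrite setTI.
  by apply: integ_cont; apply: cont_continuous; exact: test_cont.
have dphi x : is_derive x 1 phi (chi x).
  have x1 : x < x + 1 by rewrite ltrDl.
  have ichix : mu.-integrable `]-oo, x + 1] (EFin \o chi) by apply: integrableS ichi.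
  have [dx dxE] := @continuous_FTC1 R chi -oo%O x (x + 1) x1 ichix (ltNyr _) (@test_cont _ tchi x).
  by rewrite -dxE derive1E; exact: derivableP.
have dE : derive1 phi = chi by exact: der_derive1.
exists phi => //; split.
  case => [|n] x; first by case: (dphi x).
  by rewrite derive1Sn dE; exact: tchi.1.
exists `[s, t]%classic; split; first exact: segment_compact.
  by apply: subset_itv; rewrite bnd_simp.
move=> x /= /negP; rewrite in_itv /= negb_and -!ltNge => /orP[xs|tx].
  rewrite /phi (eq_Rintegral _ (g := fun=> 0)).
    by rewrite /Rintegral integral0.
  move=> y; rewrite inE /= in_itv /= => yx; apply: hst.
  by rewrite negb_and -ltNge (le_lt_trans yx).
rewrite -chi0 /phi /Segment.total /Segment.prim Rintegral_mkcond [RHS]Rintegral_mkcond.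
congr (Rintegral _ _ _); apply/funext => y; rewrite -chiR patchE.
case: ifPn => // /negP; rewrite inE /= in_itv /= => /negP; rewrite -ltNge => xy.
by apply/esym/hst; rewrite negb_and -!ltNge (lt_trans tx xy) orbT.
Qed.

(** Dominated convergence with bound [|F|]. Integrals against test functions thereby determine the
    increments of [prim F]. *)
Lemma total_bump_cvg F s t : p <= s -> s < t -> t <= r -> integ F ->
  total (fun x => F x * bump s t m x) @[m --> \oo] --> prim F t - prim F s.
Proof.
move=> ps st tr iF.
have pi : p <= r <= r by rewrite lexx ltW.
pose g := F \_ `]s, t[.
have stpr : `]s, t[ `<=` `[p, r] by apply: subset_itv; rewrite bnd_simp.
have ig : integ g.
  have : mu.-integrable (`[p, r] `&` `]s, t[) (EFin \o F).
    by rewrite setIidr//; apply: integrableS iF.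
  by move=> /integrable_restrict h; rewrite /Segment.integ /g -restrict_EFin; apply: h.
have -> : prim F t - prim F s = total g.
  rewrite /Segment.total /Segment.prim /g -Rintegral_mkcondr setIidr//.
  rewrite Rintegral_itvB ?bnd_simp ?(ltW st)//; last by apply: integS iF; rewrite ?(ltW (le_lt_trans ps st)).
  rewrite Rintegral_itv_bndo_bndc//.
  by apply: integrableS iF.
apply: fine_cvg; rewrite fineK; last exact: integrable_fin_num.
have mF : measurable_fun `[p, r] F by have /measurable_int/measurable_EFinP := iF.
have := @dominated_convergence _ _ _ mu `[p, r]%classic (measurable_itv _)
  (fun m x => (F x * bump s t m x)%:E) (EFin \o g) (fun x => `|F x|%:E).
case.
- move=> m; apply/measurable_EFinP; apply: measurable_funM => //.
  apply: cont_measurable; apply: cont_continuous => x.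
  have d := derivable_der (@bump_smooth R s t m 0%N x); exact: (der_continuous d).
- exact: (measurable_int mu).
- apply: aeW => x _ /=; rewrite /g patchE; apply: cvg_EFin; first by near=> m.
  case: ifPn; rewrite ?inE ?notin_setE /= in_itv /= => xst.
    by rewrite -[X in _ --> X]mulr1; apply: cvgMr; exact: bump_cvg.
  rewrite (_ : _ \o _ = (fun=> 0)); first exact: cvg_cst.
  by apply/funext => m /=; rewrite bump_out ?mulr0//; apply/negP.
- exact: integrable_norm.
- apply: aeW => x m _ /=; rewrite lee_fin normrM (ger0_norm (bump_ge0 _ _ _ _)).
  by rewrite ler_piMr ?bump_le1.
by [].
Unshelve. all: by end_near. Qed.

(** Bumps show that [prim F] is constant inside the interval, and by Lebesgue differentiation its
    derivative is [F] almost everywhere. *)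
Lemma eqae_test0 F : integ F ->
  (forall phi, test phi -> total (fun x => F x * phi x) = 0) -> eqae F (fun=> 0).
Proof.
move=> iF h.
have Fc s t : p < s -> s < t -> t < r -> prim F t = prim F s.
  move=> ps st tr; apply/eqP; rewrite -subr_eq0; apply/eqP.
  have := total_bump_cvg (ltW ps) st (ltW tr) iF.
  rewrite (_ : (fun m => _) = (fun=> 0)); last by apply/funext => m; apply: h; exact: bump_test.
  by move=> /cvg_lim <- //; rewrite lim_cst.
(* The differentiation theorem is applied to the primitive from [-oo] of [F] extended by zero. *)
have iF' : mu.-integrable setT (EFin \o F \_ `[p, r]).
  by rewrite -restrict_EFin; apply/integrable_restrict => //=; rewrite setTI.
have lF := integrable_locally (measurable_itv `[p, r]) iF.
have iNy y : mu.-integrable `]-oo, y] (EFin \o F \_ `[p, r]) by apply: integrableS iF'.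
have dF := FTC1Ny iNy lF.
move: dF; apply: filterS; first exact: (ae_filter_ringOfSetsType mu).
move=> x [_ dx] /=; rewrite in_itv /= => /andP[px xr].
move: dx; rewrite patchE mem_set ?inE /= ?in_itv /= ?(ltW px) ?(ltW xr)// => <-.
rewrite derive1E.
(* Near [x] that primitive keeps the value [prim F x0], where [x0] is any point between [p] and [x];
   so its derivative is 0. *)
pose x0 := (p + x) / 2.
have := @near_eq_is_derive R R R (fun=> prim F x0) _ x 1 0 _ (der_cst (prim F x0) x).
move=> /(_ (fun y => \int[mu]_(t in `]-oo, y]) (F \_ `[p, r]) t)) [| _ ->//].
near=> y.
have py : p < y by near: y; exact: lt_nbhsr.
have yr : y < r by near: y; exact: lt_nbhsl.
have x0y : x0 < y by near: y; apply: lt_nbhsr; rewrite /x0; lra.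
rewrite -(Fc x0 y) //; last by rewrite /x0; lra.
rewrite /Segment.prim Rintegral_mkcond [RHS]Rintegral_mkcond.
congr (Rintegral _ _ _); apply/funext => z; rewrite !patchE.
rewrite !mem_setE !in_itv /=.
case: (leP p z) => pz; case: (leP z y) => zy //=.
  by rewrite (le_trans zy (ltW yr)).
Unshelve. all: by end_near. Qed.

Lemma test_cont_on phi : test phi -> cont phi.
Proof. by move=> tphi; apply: cont_continuous; exact: test_cont. Qed.

Lemma test_integ phi : test phi -> integ phi.
Proof. by move=> tphi; apply: integ_cont; exact: test_cont_on. Qed.

Lemma integ_test f phi : integ f -> test phi -> integ (fun x => f x * phi x).
Proof. by move=> fi tphi; apply: integM => //; exact: test_cont_on. Qed.

Lemma test_mean1 : exists2 b, test b & total b = 1.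
Proof.
pose s := p + (r - p) / 3; pose t := p + (r - p) / 3 * 2.
have pr' := pr.
have [ps st tr] : [/\ p < s, s < t & t < r] by rewrite /s /t; split; lra.
have ic1 : integ (fun=> 1) by exact: integ_cst.
have [m m0] : exists m, total (bump s t m) != 0.
  (* The integrals of the bumps tend to [t - s > 0], so they cannot all vanish. *)
  apply: contrapT => H; have := total_bump_cvg (ltW ps) st (ltW tr) ic1.
  rewrite (_ : (fun m => _) = (fun=> 0)).
    move=> /cvg_lim; rewrite lim_cst// => /(_ (@Rhausdorff R)).
    rewrite !prim_cst ?ltW//; last exact: lt_trans st.
    by move=> E; move: st; rewrite -subr_gt0; lra.
  apply/funext => m; apply/eqP/negPn/negP => /negP m0; apply: H; exists m.
  apply/negP => /eqP E; apply: m0; rewrite -E; apply/eqP.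
  by apply: totalE => // x _; rewrite mul1r.
have tb := bump_test m ps tr.
(* The bump divided by its integral, in the shape [phi - c * psi] covered by [test_comb]. *)
exists (fun x => bump s t m x - (1 - (total (bump s t m))^-1) * bump s t m x).
  exact: test_comb.
have ib := test_integ tb.
by rewrite totalB ?totalZ//; [field|exact: integZ].
Qed.

Lemma test_antiderivative_mean1 b chi : test b -> total b = 1 -> test chi ->
  exists2 phi, test phi & derive1 phi = (fun x => chi x - total chi * b x).
Proof.
move=> tb b1 tchi; apply: test_antiderivative; first exact: test_comb.
have ib := test_integ tb; have ic := test_integ tchi.
by rewrite totalB ?totalZ ?b1 ?mulr1 ?subrr//; exact: integZ.
Qed.

(** Every test function [chi] is a derivative up to [total chi * b]. Testing [F] on derivatives is
    therefore the same as testing [F - k] on all [chi], where [k] is the pairing of [F] with [b]. *)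
Lemma du_bois_reymond F : integ F ->
  (forall phi, test phi -> total (fun x => F x * derive1 phi x) = 0) ->
  exists k, eqae F (fun=> k).
Proof.
move=> iF h; have [b tb b1] := test_mean1.
pose k := total (fun x => F x * b x); exists k.
have E0 : eqae (fun x => F x - k) (fun=> 0).
  apply: eqae_test0; first by apply: integB => //; exact: integ_cst.
  move=> chi tchi.
  have [phi tphi phiE] := test_antiderivative_mean1 tb b1 tchi.
  have := h _ tphi; rewrite phiE.
  rewrite (@totalE _ _ _ _ _ (fun x => F x * chi x - total chi * (F x * b x))) //; last first.
    by move=> x _; ring.
  have iFb := integ_test iF tb; have iFc := integ_test iF tchi; have ic := test_integ tchi.
  rewrite totalB ?totalZ//; last exact: integZ.
  rewrite (@totalE _ _ _ _ (fun x => (F x - k) * chi x) (fun x => F x * chi x - k * chi x)) //; last first.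
    by move=> x _; ring.
  rewrite totalB ?totalZ//; last exact: integZ.
  by move=> <-; rewrite /k; ring.
by apply: filterS E0 => x /= + xI => /(_ xI)/eqP; rewrite subr_eq0 => /eqP.
Qed.

Lemma total_by_parts_test phi f : test phi -> integ f ->
  total (fun x => prim f x * derive1 phi x) = - total (fun x => f x * phi x).
Proof.
move=> tphi fi; rewrite prim_by_parts//; last by apply: test_integ; exact: test_derive1.
rewrite test_total// mulr0 sub0r; congr (- _).
by apply: totalE => // x xI; rewrite test_prim.
Qed.

Lemma aff_cont c : cont (fun x => c * (x - p)).
Proof.
apply: cont_continuous => x.
by have := der_aff c (- p) x => /der_continuous.
Qed.

(** If [phi' = chi - total chi * b], the hypothesis on [phi''] says that [F] pairs with [chi'] to
    [total chi] times its pairing with [b'], that is, to [- B * total chi]. The function [B (x - p)]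
    pairs with [chi'] to the same value, so the first-order lemma applies to the difference. *)
Lemma du_bois_reymond2 F : integ F ->
  (forall phi, test phi -> total (fun x => F x * derive1 (derive1 phi) x) = 0) ->
  exists A B, eqae F (fun x => A + B * (x - p)).
Proof.
move=> iF h; have [b tb b1] := test_mean1.
pose B := - total (fun x => F x * derive1 b x).
have iB : integ (fun x => B * (x - p)) by apply: integ_cont; exact: aff_cont.
have [] := @du_bois_reymond (fun x => F x - B * (x - p)).
- exact: integB.
- move=> chi tchi.
  have [phi tphi phiE] := test_antiderivative_mean1 tb b1 tchi.
  have := h _ tphi; rewrite phiE.
  have tb' := test_derive1 tb; have tc' := test_derive1 tchi.
  rewrite (_ : derive1 _ = (fun x => derive1 chi x - total chi * derive1 b x)); last first.
    by apply: der_derive1 => x; apply: derB; [exact: test_der|apply: derZ; exact: test_der].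
  have iFb := integ_test iF tb'; have iFc := integ_test iF tc'.
  have ic := integ_test iB tc'.
  rewrite (@totalE _ _ _ _ _ (fun x => F x * derive1 chi x - total chi * (F x * derive1 b x))) //; last first.
    by move=> x _; ring.
  rewrite totalB ?totalZ//; last exact: integZ.
  rewrite (@totalE _ _ _ _ (fun x => (F x - _) * _) (fun x => F x * derive1 chi x - B * (x - p) * derive1 chi x)) //; last first.
    by move=> x _; ring.
  rewrite totalB//.
  have -> : total (fun x => B * (x - p) * derive1 chi x) = - B * total chi.
    have := total_by_parts_test tchi (integ_cst p r B).
    rewrite totalZ ?mulNr//; last exact: test_integ.
    by move=> <-; apply: totalE => // x /andP[px _]; rewrite prim_cst.
  by move=> <-; rewrite /B opprK mulrC.
move=> A hA; exists A, B.
by apply: filterS hA => x /= + xI => /(_ xI) <-; ring.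
Qed.

Lemma total_by_parts_test2 phi v : test phi -> integ v ->
  total (fun x => prim (prim v) x * derive1 (derive1 phi) x) = total (fun x => v x * phi x).
Proof.
move=> tphi iv; rewrite total_by_parts_test//; last 2 first.
- exact: test_derive1.
- by apply: integ_cont; exact: prim_cont.
by rewrite total_by_parts_test// opprK.
Qed.

Lemma weak_der2 f v : integ f -> integ v ->
  (forall phi, test phi ->
    total (fun x => f x * derive1 (derive1 phi) x) = total (fun x => v x * phi x)) ->
  exists A B, eqae f (fun x => A + B * (x - p) + prim (prim v) x).
Proof.
move=> fi iv h.
have iV : integ (prim (prim v)) by do 2 (apply/integ_cont/prim_cont => //).
have [] := @du_bois_reymond2 (fun x => f x - prim (prim v) x).
- exact: integB.
- move=> phi tphi; have t2 := test_derive1 (test_derive1 tphi).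
  rewrite (@totalE _ _ _ _ _ (fun x => f x * derive1 (derive1 phi) x - prim (prim v) x * derive1 (derive1 phi) x)) //; last first.
    by move=> x _; ring.
  by rewrite totalB ?h ?total_by_parts_test2 ?subrr//; exact: integ_test.
move=> A [B hAB]; exists A, B.
by apply: filterS hAB => x /= + xI => /(_ xI) <-; ring.
Qed.

(** Both functions have the same primitive, hence the same derivative of it at interior points;
    one-sided limits reach the endpoints. *)
Lemma cont_eqae f g : cont f -> cont g -> eqae f g -> forall x, p <= x <= r -> f x = g x.
Proof.
move=> cf cg fg.
have P x : p <= x <= r -> prim f x = prim g x.
  by move=> xI; apply: (@eqae_prim R p r) => //; exact: integ_cont.
have E x : p < x < r -> f x = g x.
  move=> /andP[px xr]; have xI : p < x < r by rewrite px.
  have df := prim_derive pr cf xI; have dg := prim_derive pr cg xI.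
  have := near_eq_is_derive _ df => /(_ (prim g)) []; last first.
    by move=> _ <-; case: dg.
  near=> y; apply: P; rewrite !ltW//.
    by near: y; exact: lt_nbhsl.
  by near: y; exact: lt_nbhsr.
have [_ fp fr] := (continuous_within_itvP f pr).1 cf.
have [_ gp gr] := (continuous_within_itvP g pr).1 cg.
move=> x /andP[]; rewrite le_eqVlt => /predU1P[<- _|px].
  suff : g x @[x --> p^'+] --> f p by move=> /cvg_unique; apply.
  apply: cvg_trans fp; apply: near_eq_cvg; near=> y; apply: E.
  by apply/andP; split; near: y; [exact: nbhs_right_gt|exact: nbhs_right_lt].
rewrite le_eqVlt => /predU1P[->|xr]; last by apply: E; rewrite px.
suff : g x @[x --> r^'-] --> f r by move=> /cvg_unique; apply.
apply: cvg_trans fr; apply: near_eq_cvg; near=> y; apply: E.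
by apply/andP; split; near: y; [exact: nbhs_left_gt|exact: nbhs_left_lt].
Unshelve. all: by end_near. Qed.

End TestFunctions.

Local Open Scope complex_scope.
Local Notation Re := complex.Re.
Local Notation Im := complex.Im.

(** * Reduction of the complex notions to real and imaginary parts *)

Section Components.
Context {R : realType} (p r : R).
Hypothesis pr : p < r.
Local Notation mu := (@lebesgue_measure R).
Local Notation Om := (`]p, r[%classic : set R).
Implicit Types (f g : R -> R[i]) (u v : R -> R).

Lemma integ_open u : mu.-integrable Om (EFin \o u) -> integ p r u.
Proof.
move=> /integrableP[mu_ iu]; apply/integrableP.
have mc : measurable_fun `[p, r] u.
  by apply: (@measurable_fun_itv_cc _ _ _ false true); apply/measurable_EFinP.
split; first exact/measurable_EFinP.
rewrite (_ : (\int[mu]_(x in `[p, r]) _)%E = (\int[mu]_(x in `]p, r[) `|(EFin \o u) x|)%E) //.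
by apply: integral_itv_bndoo; apply: measurableT_comp.
Qed.

Lemma open_integ u : integ p r u -> mu.-integrable Om (EFin \o u).
Proof. by apply: integrableS => //; apply: subset_itv; rewrite bnd_simp. Qed.

Lemma Rintegral_open u : integ p r u -> \int[mu]_(x in Om) u x = total p r u.
Proof.
move=> /open_integ iu; rewrite /total /prim /Rintegral; congr fine; apply/esym.
by apply: integral_itv_bndoo; exact: (measurable_int mu).
Qed.

Lemma CintegralE f : integ p r (fun x => Re (f x)) -> integ p r (fun x => Im (f x)) ->
  Cintegral Om f = (total p r (fun x => Re (f x))) +i* (total p r (fun x => Im (f x))).
Proof. by move=> fi gi; rewrite /Cintegral !Rintegral_open. Qed.

Lemma L2P f : L2 Om f <-> sqint p r (fun x => Re (f x)) /\ sqint p r (fun x => Im (f x)).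
Proof.
split=> [[mR mI /integ_open iS]|[[mR iR] [mI iI]]].
  have {}mR : measurable_fun `[p, r] (fun x => Re (f x)).
    exact: (@measurable_fun_itv_cc _ _ _ false true).
  have {}mI : measurable_fun `[p, r] (fun x => Im (f x)).
    exact: (@measurable_fun_itv_cc _ _ _ false true).
  split; split=> //; apply: le_integrable iS => //=.
  - by apply/measurable_EFinP; exact: measurable_funX.
  - by move=> x _; rewrite lee_fin !ger0_norm ?addr_ge0 ?sqr_ge0// lerDl sqr_ge0.
  - by apply/measurable_EFinP; exact: measurable_funX.
  - by move=> x _; rewrite lee_fin !ger0_norm ?addr_ge0 ?sqr_ge0// lerDr sqr_ge0.
have s : Om `<=` `[p, r] by apply: subset_itv; rewrite bnd_simp.
split.
- exact: measurable_funS mR.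
- exact: measurable_funS mI.
- by apply: open_integ; exact: integD.
Qed.

Lemma L2_real u : sqint p r u -> L2 Om (fun x => (u x)%:C).
Proof.
move=> su; apply/L2P; split; first exact: su.
by apply: cont_sqint; exact: cont_cst.
Qed.

Lemma inner_realr f u : L2 Om f -> sqint p r u ->
  inner Om f (fun x => (u x)%:C) =
  (total p r (fun x => Re (f x) * u x)) +i* (total p r (fun x => Im (f x) * u x)).
Proof.
move=> /L2P[sR sI] su; rewrite /inner.
rewrite (_ : (fun x => _) = (fun x => (Re (f x) * u x) +i* (Im (f x) * u x))).
  by rewrite CintegralE //; exact: sqintM.
by apply/funext => x; case: (f x) => y z /=; simpc.
Qed.

Lemma inner_reall f u : L2 Om f -> sqint p r u ->
  inner Om (fun x => (u x)%:C) f =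
  (total p r (fun x => u x * Re (f x))) -i* (total p r (fun x => u x * Im (f x))).
Proof.
move=> /L2P[sR sI] su; rewrite /inner.
rewrite (_ : (fun x => _) = (fun x => (u x * Re (f x)) +i* (-1 * (u x * Im (f x))))).
  rewrite CintegralE /comp /=; last 2 first.
  - exact: sqintM.
  - by apply: integZ; exact: sqintM.
  by rewrite totalZ ?mulN1r//; exact: sqintM.
by apply/funext => x; case: (f x) => y z /=; simpc; congr (_ +i* _); ring.
Qed.

Lemma weak_derivativeP n f g : L2 Om f -> L2 Om g -> weak_derivative Om n f g <->
  forall phi, test_function Om phi ->
    total p r (fun x => Re (f x) * derive1n n phi x) =
      (-1) ^+ n * total p r (fun x => Re (g x) * phi x) /\
    total p r (fun x => Im (f x) * derive1n n phi x) =
      (-1) ^+ n * total p r (fun x => Im (g x) * phi x).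
Proof.
move=> /L2P[fR fI] /L2P[gR gI].
have tn phi : test_function Om phi -> test_function Om (derive1n n phi).
  by move=> tphi; elim: n => [//|n IH]; exact: test_derive1.
have prod h u : sqint p r (fun x => Re (h x)) -> sqint p r (fun x => Im (h x)) -> test_function Om u ->
    Cintegral Om (fun x => h x * (u x)%:C) =
    (total p r (fun x => Re (h x) * u x)) +i* (total p r (fun x => Im (h x) * u x)).
  move=> hR hI tu.
  rewrite (_ : (fun x => _) = (fun x => (Re (h x) * u x) +i* (Im (h x) * u x))).
    by rewrite CintegralE //; apply: integ_test => //; exact: sqint_integ.
  by apply/funext => x; case: (h x) => y z /=; simpc.
have sgn z : (-1) ^+ n * z = ((-1) ^+ n * Re z) +i* ((-1) ^+ n * Im z) :> R[i].
  elim: n {tn} => [|m IH]; first by case: z => y z; rewrite !expr0 !mul1r.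
  by rewrite !exprS -!mulrA IH !mulN1r.
split=> h phi tphi.
  have := h _ tphi; rewrite !prod//; last exact: tn.
  by rewrite sgn /= => -[-> ->].
rewrite !prod//; last exact: tn.
by rewrite sgn /=; have [-> ->] := h _ tphi.
Qed.

Lemma total_sq0 u : sqint p r u -> total p r (fun x => u x ^+ 2) = 0 ->
  eqae p r u (fun=> 0).
Proof.
move=> [mu_ iu] u0.
have u00 : (\int[mu]_(x in `[p, r]) (u x ^+ 2)%:E = 0)%E.
  rewrite -[LHS]fineK ?integrable_fin_num//.
  by have := u0; rewrite /total /prim /Rintegral => ->.
have u01 : (\int[mu]_(x in `[p, r]) `|(u x ^+ 2)%:E|)%E = 0.
  rewrite -[RHS]u00; apply: eq_integral => x _.
  by rewrite gee0_abs// lee_fin sqr_ge0.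
have m2 : measurable_fun `[p, r] (fun x => (u x ^+ 2)%:E).
  by apply/measurable_EFinP; exact: measurable_funX.
have := (ae_eq_integral_abs mu (measurable_itv _) m2).1 u01.
apply: filterS => x /= + xI; rewrite /= in_itv /= => E.
have /eqP : u x ^+ 2 = 0.
  by apply: EFin_inj; apply: E; move: xI; rewrite /= in_itv /= => /andP[/ltW -> /ltW].
by rewrite sqrf_eq0 => /eqP.
Qed.

End Components.

(** * The adjoint *)

Section Kernel.
Context {R : realType} (p r c : R).
Hypotheses (pc : p < c) (cr : c < r).
Local Notation integ := (integ p r).
Local Notation sqint := (sqint p r).
Local Notation cont := (cont p r).
Local Notation prim := (prim p).
Local Notation total := (total p r).
Local Notation eqae := (eqae p r).
Implicit Types (u v w q psi : R -> R).

Let pr : p < r. Proof. exact: lt_trans cr. Qed.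

(** The Heaviside step at [c]. Its primitive is the positive part of [x - c], so that one formula
    with a kink serves on both sides of [c]. *)
Definition after (x : R) : R := (c < x)%R%:R.

Lemma after_integ : integ after.
Proof.
apply: (@measurable_bounded_integrable) => //.
- by apply: compact_finite_measure; exact: segment_compact.
- apply: measurableT_comp => //; exact: measurable_fun_ltr.
- exists 1; split => // M M1 x _; rewrite /= /after.
  by case: ltP => _; rewrite ?normr1 ?normr0; lra.
Qed.

Lemma after_sqint : sqint after.
Proof.
have := after_integ; split; first by have /measurable_int/measurable_EFinP := H.
by rewrite (_ : (fun x => _) = after) //; apply/funext => x; rewrite /after; case: ltP => _; rewrite ?expr1n ?expr0n.
Qed.

Lemma total_after v : integ v -> integ (fun x => v x * after x) ->
  total (fun x => v x * after x) = total v - prim v c.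
Proof.
move=> vi vai; have cI : p <= c <= r by rewrite !ltW.
have s : subset `[c, r]%classic (`[p, r]%classic : set R).
  by apply: subset_itvr; rewrite bnd_simp ltW.
rewrite /Segment.total (prim_split cI vai) (prim_split cI vi).
have -> : prim (fun x => v x * after x) c = prim (fun=> 0) c.
  apply: (@primE _ p c); first by rewrite lexx ltW.
  by move=> t /andP[_ tc]; rewrite /after ltNge tc mulr0.
rewrite prim_cst ?ltW// mul0r add0r addrAC subrr add0r.
apply: (@eqae_prim _ c r); first by rewrite lexx ltW.
- exact: integrableS vai.
- exact: integrableS vi.
- by apply: aeW => x /=; rewrite in_itv /= => /andP[cx _]; rewrite /after cx mulr1.
Qed.

Lemma prim_after_r : prim after r = r - c.
Proof.
have i1 : integ (fun=> 1) by exact: integ_cst.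
have E : integ (fun x => 1 * after x).
  by apply: sqintM after_sqint; apply: cont_sqint; exact: cont_cst.
have := total_after i1 E; rewrite /Segment.total !prim_cst ?ltW//.
rewrite (@primE _ p r _ after); [|by rewrite lexx ltW|by move=> x _; rewrite mul1r].
by move=> ->; ring.
Qed.

Lemma prim_sqint v : integ v -> sqint (prim v).
Proof. by move=> vi; apply: cont_sqint => //; exact: prim_cont. Qed.

Lemma aff_sqint k : sqint (fun x => k * (x - p)).
Proof. by apply: cont_sqint => //; exact: aff_cont. Qed.

Lemma sub_sqint : sqint (fun x => x - p).
Proof.
by have := aff_sqint 1; rewrite (_ : (fun x => _) = (fun x => x - p)) //; apply/funext => x; rewrite mul1r.
Qed.

(** Integration by parts, with [x - p] as the primitive of 1. *)
Lemma total_sub v : integ v -> total (fun x => v x * (x - p)) = (r - p) * total v - prim (prim v) r.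
Proof.
move=> vi; have i1 : integ (fun=> 1) by exact: integ_cst.
rewrite (@totalE _ p r pr _ (fun x => v x * prim (fun=> 1) x)); last first.
  by move=> x /andP[px _]; rewrite prim_cst// mul1r.
have := prim_by_parts pr vi i1.
rewrite (@totalE _ p r pr _ (prim v)); last by move=> x _; rewrite mulr1.
rewrite -/(Segment.total p r (prim v)) [Segment.total p r (fun=> 1)]/Segment.total prim_cst ?ltW//.
move: (Segment.total p r _) (Segment.total p r _) (Segment.total p r _) => X Y Z ->; ring.
Qed.

(* [total_corner]: [v] is in the range of [H] iff it is orthogonal to [corner]. *)
Definition corner x : R := (c - r) * (x - p) + (r - p) * prim after x.

Lemma corner_sqint : sqint corner.
Proof. by apply: sqintD; [exact: aff_sqint|apply: sqintZ; exact: prim_sqint after_integ]. Qed.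

Lemma total_prim v q : integ v -> integ q ->
  total (fun x => v x * prim q x) = total v * total q - total (fun x => prim v x * q x).
Proof.
move=> vi qi; rewrite (prim_by_parts pr vi qi).
by move: (Segment.total p r _) (Segment.total p r _) (Segment.total p r _) => X Y Z; ring.
Qed.

(** The right side is the determinant of the system [B (c - p) = prim (prim v) c],
    [B (r - p) = prim (prim v) r]; its vanishing is the solvability for [B]. *)
Lemma total_corner v : sqint v ->
  total (fun x => v x * corner x) = (r - p) * prim (prim v) c - (c - p) * prim (prim v) r.
Proof.
move=> sv; have vi := sqint_integ sv; have Pvi := sqint_integ (prim_sqint vi).
have i1 : integ (fun x => v x * (x - p)) by exact: sqintM sv sub_sqint.
have i2 : integ (fun x => v x * prim after x) by exact: sqintM sv (prim_sqint after_integ).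
rewrite (@totalE _ p r pr _ (fun x => (c - r) * (v x * (x - p)) + (r - p) * (v x * prim after x))); last first.
  by move=> x _; rewrite /corner; ring.
rewrite totalD ?totalZ//; try exact: integZ.
rewrite total_sub// total_prim//; last exact: after_integ.
rewrite total_after//; last by exact: sqintM (prim_sqint vi) after_sqint.
rewrite [Segment.total p r after]prim_after_r [Segment.total p r (prim v)]/Segment.total.
by move: (Segment.total p r v) (prim (prim v) r) (prim (prim v) c) => X Y Z; ring.
Qed.

(** Here [w] stands for a real component of [psi] and [q] for the same component of [lam psi]; the
    hypothesis is the defining identity of the adjoint, with [u] written out through [v], [A] and
    [B]. *)
Lemma kernel_necessary w q : sqint w -> sqint q ->
  (forall v A B, sqint v -> B * (c - p) = prim (prim v) c -> B * (r - p) = prim (prim v) r ->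
    total (fun x => v x * w x) =
    total (fun x => (A + B * (x - p) - prim (prim v) x) * q x)) ->
  total q = 0 /\
  exists al J, eqae w (fun x => al * (x - p) + J * prim after x - prim (prim q) x) /\
    al * (r - p) + J * prim after r - prim (prim q) r = 0.
Proof.
move=> sw sq h; have qi := sqint_integ sq; have Pqs := prim_sqint qi.
have Pqi := sqint_integ Pqs; have PPqs := prim_sqint Pqi.
have L0 : r - p != 0 by rewrite subr_eq0 gt_eqF.
have s0 : sqint (fun=> 0) by apply: cont_sqint => //; exact: cont_cst.
have P0 x : p <= x -> prim (fun=> 0) x = 0 by move=> px; rewrite prim_cst// mul0r.
have PP0 x : p <= x <= r -> prim (prim (fun=> 0)) x = 0.
  move=> xI; rewrite (primE (g := fun=> 0) xI); first by apply: P0; case/andP: xI.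
  by move=> t /andP[/P0].
have q0 : total q = 0.
  have := h _ 1 0 s0; rewrite !mul0r !PP0 ?lexx ?ltW// => /(_ erefl erefl).
  rewrite (@totalE _ p r pr _ (fun=> 0)); last by move=> x _; rewrite mul0r.
  rewrite [Segment.total p r (fun=> 0)]/Segment.total P0 ?ltW// => ->.
  by apply: totalE => // x xI; rewrite PP0// mul0r addr0 subr0 mul1r.
split => //; set Q := prim (prim q) r.
(* The linear term makes the expected [F] vanish at [r], as [corner] does. In the pairing with [v]
   it cancels the boundary contributions [Q * total v] and [B * Q]. *)
pose F x := w x + prim (prim q) x - Q / (r - p) * (x - p).
have sF : sqint F by apply: sqintB; [exact: sqintD|exact: aff_sqint].
have hF v : sqint v -> total (fun x => v x * corner x) = 0 -> total (fun x => v x * F x) = 0.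
  move=> sv; have vi := sqint_integ sv; have Pvs := prim_sqint vi.
  have Pvi := sqint_integ Pvs; have PPvs := prim_sqint Pvi.
  rewrite total_corner// => /eqP; rewrite subr_eq0 => /eqP vc.
  pose B := prim (prim v) r / (r - p).
  have Br : B * (r - p) = prim (prim v) r by rewrite /B divfK.
  have Bc : B * (c - p) = prim (prim v) c by rewrite /B mulrAC (mulrC (prim _ _)) -vc mulrAC divff// mul1r.
  have E := h v 0 B sv Bc Br.
  have i1 : integ (fun x => v x * w x) by exact: sqintM.
  have i2 : integ (fun x => v x * prim (prim q) x) by exact: sqintM.
  have i3 : integ (fun x => v x * (x - p)) by exact: sqintM sv sub_sqint.
  have i4 : integ (fun x => q x * (x - p)) by exact: sqintM sq sub_sqint.
  have i5 : integ (fun x => prim (prim v) x * q x) by exact: sqintM.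
  rewrite (@totalE _ p r pr _ (fun x => v x * w x + v x * prim (prim q) x - Q / (r - p) * (v x * (x - p)))); last first.
    by move=> x _; rewrite /F; ring.
  rewrite totalB ?totalD ?totalZ//; last 2 first.
  - exact: integD.
  - exact: integZ.
  rewrite E (@totalE _ p r pr _ (fun x => B * (q x * (x - p)) - prim (prim v) x * q x)); last first.
    by move=> x _; ring.
  rewrite totalB ?totalZ//; last exact: integZ.
  rewrite !total_sub// total_prim// prim_by_parts// q0.
  rewrite -Br.
  rewrite -[Segment.total p r (prim q)]/Q.
  rewrite -/Q; move: (Segment.total p r v) (Segment.total p r _) => X Y.
  clearbody Q B; clear -L0; by field.
(* The coefficient of the projection of [F] on [corner]. *)
pose k := total (fun x => F x * corner x) / total (fun x => corner x ^+ 2).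
pose v x := F x - k * corner x.
have sv : sqint v by apply: sqintB => //; apply: sqintZ; exact: corner_sqint.
have iFc : integ (fun x => F x * corner x) by exact: sqintM sF corner_sqint.
have icc : integ (fun x => corner x ^+ 2) by case: corner_sqint.
have vc : total (fun x => v x * corner x) = 0.
  rewrite (@totalE _ p r pr _ (fun x => F x * corner x - k * corner x ^+ 2)); last first.
    by move=> x _; rewrite /v; ring.
  rewrite totalB ?totalZ//; last exact: integZ.
  (* If [corner] had norm zero, the division would return 0, but [corner] would then vanish almost
     everywhere and the orthogonality would hold all the same. *)
  have [c0|c0] := eqVneq (total (fun x => corner x ^+ 2)) 0; last by rewrite /k divfK// subrr.
  rewrite c0 mulr0 subr0 -(P0 r (ltW pr)) -[RHS]/(Segment.total p r (fun=> 0)).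
  apply: eqae_total => //; first exact: sqint_integ s0.
  have := total_sq0 corner_sqint c0.
  by apply: filterS => x /= + xI => /(_ xI) ->; rewrite mulr0.
(* Orthogonal to [corner], [v] is orthogonal to [F] by [hF], hence to itself. *)
have v0 : eqae v (fun=> 0).
  apply: total_sq0 => //.
  have ivF : integ (fun x => v x * F x) by exact: sqintM sv sF.
  have ivc : integ (fun x => v x * corner x) by exact: sqintM sv corner_sqint.
  rewrite (@totalE _ p r pr _ (fun x => v x * F x - k * (v x * corner x))); last first.
    by move=> x _; rewrite (_ : F x = v x + k * corner x) /v ?subrK//; ring.
  by rewrite totalB ?totalZ//; [rewrite hF// vc mulr0 subr0|exact: integZ].
(* The coefficients are read off from [F = k * corner]. *)
exists (k * (c - r) + Q / (r - p)), (k * (r - p)); split.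
  apply: filterS v0 => x /= + xI => /(_ xI) /eqP; rewrite /v subr_eq0 => /eqP.
  rewrite /F /corner => E; apply/eqP; rewrite -subr_eq0; apply/eqP.
  move: E => /eqP; rewrite -subr_eq0 => /eqP <-; ring.
rewrite prim_after_r -/Q; clearbody Q; clear -L0; by field.
Qed.

(* [psi = prim w1] and [w1] jumps by [J] at [c]: two integrations by parts reduce
   the pairing with [v] to the pairing with [u]. *)
Lemma kernel_sufficient lam psi w1 al J u v A B :
  sqint psi -> integ w1 ->
  (forall x, p <= x <= r -> psi x = prim w1 x) -> psi r = 0 ->
  (forall x, p <= x <= r -> w1 x = al + J * after x - lam * prim psi x) ->
  lam * total psi = 0 ->
  sqint v -> sqint u -> eqae u (fun x => A + B * (x - p) - prim (prim v) x) ->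
  B * (c - p) = prim (prim v) c -> B * (r - p) = prim (prim v) r ->
  total (fun x => v x * psi x) = lam * total (fun x => u x * psi x).
Proof.
move=> spsi iw1 psiE psir w1E lt0 sv su uE Bc Br.
have psii := sqint_integ spsi; have Ppsis := prim_sqint psii.
have Ppsii := sqint_integ Ppsis.
have vi := sqint_integ sv; have Pvs := prim_sqint vi.
have Pvi := sqint_integ Pvs; have PPvs := prim_sqint Pvi.
have rI : p <= r <= r by rewrite lexx ltW.
have i1 : integ (fun x => prim v x * after x) by exact: sqintM Pvs after_sqint.
have i2 : integ (fun x => prim v x * prim psi x) by exact: sqintM.
have i3 : integ (fun x => psi x * (x - p)) by exact: sqintM spsi sub_sqint.
have i4 : integ (fun x => prim (prim v) x * psi x) by exact: sqintM.
have i5 : integ (fun x => A * psi x + B * (psi x * (x - p))) by apply: integD; exact: integZ.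
have i6 : integ (fun x => al * prim v x + J * (prim v x * after x)) by apply: integD; exact: integZ.
have -> : total (fun x => u x * psi x) =
    B * total (fun x => psi x * (x - p)) - total (fun x => prim (prim v) x * psi x) + A * total psi.
  rewrite (@eqae_total _ p r pr _ (fun x => A * psi x + B * (psi x * (x - p)) - prim (prim v) x * psi x)) //.
  - rewrite totalB ?totalD ?totalZ//; try exact: integZ.
    by move: (Segment.total p r _) (Segment.total p r _) (Segment.total p r _) => X Y Z; ring.
  - exact: sqintM.
  - exact: integB.
  - by apply: filterS uE => x /= + xI => /(_ xI) ->; ring.
have w1r : al * (r - p) + J * (r - c) - lam * total (prim psi) = 0.
  rewrite -psir psiE// -[RHS]/(Segment.total p r w1) (totalE pr w1E).
  have ia : integ (fun x => al + J * after x) by apply: integD; [exact: integ_cst|apply: integZ; exact: after_integ].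
  rewrite totalB ?totalD ?totalZ//; try exact: after_integ; try exact: integ_cst; try exact: integZ.
    by rewrite [Segment.total p r after]prim_after_r [Segment.total p r (fun=> al)]/Segment.total prim_cst// ltW.
  by apply: integZ; exact: after_integ.
have -> : total (fun x => v x * psi x) = - total (fun x => prim v x * w1 x).
  rewrite (@totalE _ p r pr _ (fun x => v x * prim w1 x)); last by move=> x xI; rewrite psiE.
  by rewrite total_prim// [Segment.total p r w1](_ : _ = 0) ?mulr0 ?sub0r// -psir psiE.
rewrite (@totalE _ p r pr _ (fun x => al * prim v x + J * (prim v x * after x) - lam * (prim v x * prim psi x))); last first.
  by move=> x xI; rewrite w1E//; ring.
rewrite totalB ?totalD ?totalZ//; try exact: integZ.
rewrite total_after// total_prim// total_sub//.
rewrite [Segment.total p r (prim v)]/Segment.total -Bc -Br.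
move: w1r lt0; rewrite [Segment.total p r (prim psi)]/Segment.total.
move: (prim (prim psi) r) (Segment.total p r psi) => X Z E1 E2.
move: (Segment.total p r _) => T; apply/eqP; rewrite -subr_eq0; apply/eqP.
(* The two sides differ by a combination of two quantities that vanish: the value of [psi] at [r]
   and [lam] times its mean. *)
transitivity (- B * (al * (r - p) + J * (r - c) - lam * X) - A * (lam * Z)).
  ring.
by rewrite E1 E2; ring.
Qed.

End Kernel.

(** * The graph of [H] by double primitives, and the equations of its adjoint *)

Section Domain.
Context {R : realType} (a : R).
Hypotheses (a_gtN1 : -1 < a) (a_lt1 : a < 1).
Local Notation p := (- (pi / 2) : R).
Local Notation r := (pi / 2 : R).
Local Notation c := (pi / 2 * a : R).
Local Notation integ := (integ p r).
Local Notation sqint := (sqint p r).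
Local Notation cont := (cont p r).
Local Notation prim := (prim p).
Local Notation total := (total p r).
Local Notation eqae := (eqae p r).
Implicit Types (u v w q psi : R -> R).

Lemma left_lt : p < c.
Proof. have pi0 := @pi_gt0 R; have h1 := a_gtN1; have : 0 < pi * (1 + a) by apply: mulr_gt0 => //; lra.
by move: pi0; move: (pi : R) => P; nra. Qed.

Lemma right_lt : c < r.
Proof. by rewrite gtr_pMr// divr_gt0 ?pi_gt0. Qed.

Let pc := left_lt.
Let cr := right_lt.
Let pr : p < r. Proof. exact: lt_trans pc cr. Qed.

Lemma H_sqint (U V : R -> R[i]) : H a U V ->
  [/\ sqint (fun x => Re (U x)), sqint (fun x => Im (U x)),
      sqint (fun x => Re (V x)) & sqint (fun x => Im (V x))].
Proof.
by move=> [[[/L2P[? ?] _] _] /L2P[? ?] _].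
Qed.

(** The boundary conditions concern the continuous representative [ut]. By [cont_eqae] it equals the
    double-primitive formula at every point, in particular at [p], [c] and [r]. The signs come from
    the weak second derivative being [- v]. *)
Let structure_component u v ut : sqint u -> sqint v -> cont ut -> eqae u ut ->
  ut p = ut c -> ut c = ut r ->
  (forall phi, test_function (`]p, r[%classic : set R) phi ->
     total (fun x => u x * derive1 (derive1 phi) x) = total (fun x => - v x * phi x)) ->
  exists A B, [/\ eqae u (fun x => A + B * (x - p) - prim (prim v) x),
    B * (c - p) = prim (prim v) c & B * (r - p) = prim (prim v) r].
Proof.
move=> su sv cut uut utpc utcr h.
have ui := sqint_integ su; have vi := sqint_integ sv.
have Pvi : integ (prim v) by apply/integ_cont/prim_cont.
have Nvi : integ (fun x => - v x).
  have := integZ (-1) vi; rewrite (_ : (fun x => _) = (fun x => - v x)) //.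
  by apply/funext => x; rewrite mulN1r.
have [A [B E]] := weak_der2 pr ui Nvi h.
have PN f x : p <= x <= r -> integ f -> prim (fun t => - f t) x = - prim f x.
  move=> xI fi; rewrite -[RHS]mulN1r -(@primZ _ p r (-1) f x xI fi); apply: (primE xI) => t _.
  by rewrite mulN1r.
have PPN x : p <= x <= r -> prim (prim (fun x => - v x)) x = - prim (prim v) x.
  move=> xI; rewrite -(PN _ _ xI Pvi); apply: (primE xI) => t tI; exact: PN.
have E' : eqae u (fun x => A + B * (x - p) - prim (prim v) x).
  apply: filterS E => x /= + xI => /(_ xI) ->.
  by rewrite PPN //; move: xI; rewrite /= in_itv /= => /andP[/ltW -> /ltW ->].
have cF : cont (fun x => A + B * (x - p) - prim (prim v) x).
  apply: contB; last exact: prim_cont.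
  by apply: contD; [exact: cont_cst|exact: aff_cont].
have utE : forall x, p <= x <= r -> ut x = A + B * (x - p) - prim (prim v) x.
  by apply: (cont_eqae pr cut cF); apply: filterS2 uut E' => x /= h1 h2 xI; rewrite -h1// h2.
exists A, B; split => //.
- move: utpc; rewrite !utE ?lexx ?ltW// prim0; lra.
- move: utpc; rewrite utcr !utE ?lexx ?ltW// prim0; lra.
Qed.

Lemma H_structure (U V : R -> R[i]) : H a U V ->
  (exists A B, [/\ eqae (fun x => Re (U x)) (fun x => A + B * (x - p) - prim (prim (fun x => Re (V x))) x),
    B * (c - p) = prim (prim (fun x => Re (V x))) c & B * (r - p) = prim (prim (fun x => Re (V x))) r]) /\
  (exists A B, [/\ eqae (fun x => Im (U x)) (fun x => A + B * (x - p) - prim (prim (fun x => Im (V x))) x),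
    B * (c - p) = prim (prim (fun x => Im (V x))) c & B * (r - p) = prim (prim (fun x => Im (V x))) r]).
Proof.
move=> /[dup] /H_sqint[uR uI vR vI] [[[lU _] [ut [[cR cI uut] utpc utcr]]] lV wd].
have lNV : L2 I0 (fun x => - V x).
  apply/L2P; split.
    have := sqintZ (-1) vR; rewrite (_ : (fun x => -1 * _) = (fun x => Re (- V x))) //.
    by apply/funext => x; case: (V x) => y z /=; rewrite mulN1r.
  have := sqintZ (-1) vI; rewrite (_ : (fun x => -1 * _) = (fun x => Im (- V x))) //.
  by apply/funext => x; case: (V x) => y z /=; rewrite mulN1r.
have := (weak_derivativeP 2 lU lNV).1 wd; rewrite expr2 mulrNN mulr1 => wd'.
split.
- apply: (structure_component (ut := fun x => Re (ut x))) => //.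
  + by apply: filterS uut => x /= + xI => /(_ xI) ->.
  + by rewrite utpc.
  + by rewrite utcr.
  + move=> phi tphi; have [+ _] := wd' _ tphi; rewrite mul1r /= => ->.
    by apply: totalE => // x _; case: (V x).
- apply: (structure_component (ut := fun x => Im (ut x))) => //.
  + by apply: filterS uut => x /= + xI => /(_ xI) ->.
  + by rewrite utpc.
  + by rewrite utcr.
  + move=> phi tphi; have [_ +] := wd' _ tphi; rewrite mul1r /= => ->.
    by apply: totalE => // x _; case: (V x).
Qed.

(** This supplies the test pairs for the adjoint. The weak derivatives are explicit: [B - prim v] of
    order one and [- v] of order two. *)
Lemma H_intro v A B : sqint v ->
  B * (c - p) = prim (prim v) c -> B * (r - p) = prim (prim v) r ->
  H a (fun x => (A + B * (x - p) - prim (prim v) x)%:C) (fun x => (v x)%:C).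
Proof.
move=> sv Bc Br; have vi := sqint_integ sv.
have cPv := prim_cont pr vi; have Pvi := integ_cont cPv; have cPPv := prim_cont pr Pvi.
pose u x := A + B * (x - p) - prim (prim v) x.
have cu : cont u by apply: contB => //; apply: contD; [exact: cont_cst|exact: aff_cont].
have su := cont_sqint cu.
pose u' x := B - prim v x.
have cu' : cont u' by apply: contB => //; exact: cont_cst.
have Nv : sqint (fun x => - v x).
  have := sqintZ (-1) sv; rewrite (_ : (fun x => -1 * _) = (fun x => - v x)) //.
  by apply/funext => x; rewrite mulN1r.
have zero f phi : total (fun x => Im ((f x : R)%:C) * (phi x)) = 0 :> R.
  rewrite (@totalE _ p r pr _ (fun=> 0)); last by move=> x _; rewrite /= mul0r.
  by rewrite /Segment.total prim_cst ?mul0r// ltW.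
have u'E x : p <= x <= r -> u x = A + prim u' x.
  move=> xI; rewrite /u /u' (@primB _ p r)//; last exact: integ_cst.
  by rewrite prim_cst ?addrA//; case/andP: xI.
have wd1 phi : test_function (`]p, r[%classic : set R) phi ->
    total (fun x => u x * derive1 phi x) = - total (fun x => u' x * phi x).
  move=> tphi; have t1 := test_derive1 tphi.
  rewrite (@totalE _ p r pr _ (fun x => A * derive1 phi x + prim u' x * derive1 phi x)); last first.
    by move=> x xI; rewrite u'E//; ring.
  have cPu' := prim_cont pr (integ_cont cu').
  have it := test_integ t1.
  rewrite totalD ?totalZ//; last 2 first.
  - exact: integZ.
  - by apply: integ_test t1; exact: integ_cont.
  rewrite test_total// mulr0 add0r total_by_parts_test//; exact: integ_cont.
have wd2 phi : test_function (`]p, r[%classic : set R) phi ->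
    total (fun x => u' x * derive1 phi x) = total (fun x => v x * phi x).
  move=> tphi; have t1 := test_derive1 tphi.
  rewrite (@totalE _ p r pr _ (fun x => B * derive1 phi x - prim v x * derive1 phi x)); last first.
    by move=> x xI; rewrite /u'; ring.
  have it := test_integ t1.
  rewrite totalB ?totalZ//; last 2 first.
  - exact: integZ.
  - exact: integ_test t1.
  by rewrite test_total// mulr0 sub0r total_by_parts_test// opprK.
have L2u : L2 I0 (fun x => (u x)%:C) by exact: L2_real.
have L2Nv : L2 I0 (fun x => - (v x)%:C).
  rewrite (_ : (fun x => _) = (fun x => (- v x)%:C)); first exact: L2_real.
  by apply/funext => x; rewrite rmorphN.
have W2 : weak_derivative I0 2 (fun x => (u x)%:C) (fun x => - (v x)%:C).
  apply/(weak_derivativeP 2 L2u L2Nv) => phi tphi; split.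
    rewrite /= wd1; last exact: test_derive1.
    rewrite wd2// expr2 mulrNN !mul1r.
    have ip := integ_test vi tphi.
    by rewrite -mulN1r -totalZ//; apply: totalE => // x _; rewrite mulN1r mulNr.
  rewrite zero (_ : (fun x => _) = (fun x => Im ((- v x)%:C) * phi x)) ?zero ?mulr0//.
  by apply/funext => x; rewrite rmorphN.
split => //; last exact: L2_real.
split; last first.
  exists (fun x => (u x)%:C); split.
  - split; [exact: cu|exact: cont_cst|exact: aeW].
  - by rewrite /u prim0 -Bc; congr (_%:C); ring.
  - by rewrite /u -Bc -Br; congr (_%:C); ring.
split => // n; case: n => [|[|[|//]]] _.
- exists (fun x => (u x)%:C) => // phi tphi; by rewrite expr0 mul1r.
- have L2u' : L2 I0 (fun x => (u' x)%:C) by apply: L2_real => //; exact: cont_sqint.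
  exists (fun x => (u' x)%:C) => //.
  apply/(weak_derivativeP 1 L2u L2u') => phi tphi; split.
    by rewrite /= wd1// expr1 mulN1r.
  by rewrite !zero mulr0.
- by exists (fun x => - (v x)%:C).
Qed.

(** Real data suffice, since the eigenfunctions to be exhibited and their eigenvalues are real; the
    two components of an arbitrary pair of the graph are then handled separately. The function [w1]
    plays the derivative of [psi], with jump [J] at the corner. *)
Lemma adjoint_real lam psi w1 al J :
  sqint psi -> integ w1 ->
  (forall x, p <= x <= r -> psi x = prim w1 x) -> psi r = 0 ->
  (forall x, p <= x <= r -> w1 x = al + J * after c x - lam * prim psi x) ->
  lam * total psi = 0 ->
  eigenspace_of (adjoint I0 (H a)) lam%:C (fun x => (psi x)%:C).
Proof.
move=> spsi iw1 psiE psir w1E lt0; rewrite /eigenspace_of /=.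
have slpsi := sqintZ lam spsi.
have -> : (fun x => lam%:C * (psi x)%:C) = (fun x => (lam * psi x)%:C).
  by apply/funext => x; rewrite rmorphM.
split; [exact: L2_real|exact: L2_real|].
move=> U V HUV; have [uR uI vR vI] := H_sqint HUV.
have lU : L2 I0 U by exact/L2P.
have lV : L2 I0 V by exact/L2P.
rewrite !inner_realr//.
have [[A [B [E1 E2 E3]]] [A' [B' [E1' E2' E3']]]] := H_structure HUV.
have := kernel_sufficient pc cr spsi iw1 psiE psir w1E lt0 vR uR E1 E2 E3.
have := kernel_sufficient pc cr spsi iw1 psiE psir w1E lt0 vI uI E1' E2' E3'.
move=> -> ->; congr (_ +i* _); rewrite -totalZ//; try exact: sqintM.
  by apply: totalE => // x _; ring.
by apply: totalE => // x _; ring.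
Qed.

(** The functions [q1] and [q2] are the components of [lam psi]. They mix both components of [psi],
    as [lam] is not yet known to be real, but real test pairs still give one real identity for
    each. *)
Lemma adjoint_structure (lam : R[i]) (psi : R -> R[i]) :
  eigenspace_of (adjoint I0 (H a)) lam psi ->
  let q1 x := Re lam * Re (psi x) - Im lam * Im (psi x) in
  let q2 x := Re lam * Im (psi x) + Im lam * Re (psi x) in
  [/\ sqint (fun x => Re (psi x)), sqint (fun x => Im (psi x)),
  total q1 = 0 /\
  (exists al J, eqae (fun x => Re (psi x)) (fun x => al * (x - p) + J * prim (after c) x - prim (prim q1) x) /\
    al * (r - p) + J * prim (after c) r - prim (prim q1) r = 0) &
  total q2 = 0 /\
  (exists al J, eqae (fun x => Im (psi x)) (fun x => al * (x - p) + J * prim (after c) x - prim (prim q2) x) /\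
    al * (r - p) + J * prim (after c) r - prim (prim q2) r = 0)].
Proof.
move=> [lpsi llpsi h] q1 q2; have /L2P[sR sI] := lpsi.
have lE x : lam * psi x = (q1 x) +i* (q2 x).
  by rewrite /q1 /q2; case: (lam) (psi x) => l1 l2 [y z] /=; simpc; congr (_ +i* _); ring.
have s1 : sqint q1 by apply: sqintB; exact: sqintZ.
have s2 : sqint q2 by apply: sqintD; exact: sqintZ.
have K v A B : sqint v -> B * (c - p) = prim (prim v) c -> B * (r - p) = prim (prim v) r ->
    total (fun x => v x * Re (psi x)) = total (fun x => (A + B * (x - p) - prim (prim v) x) * q1 x) /\
    total (fun x => v x * Im (psi x)) = total (fun x => (A + B * (x - p) - prim (prim v) x) * q2 x).
  move=> sv Bc Br; have := h _ _ (H_intro A sv Bc Br).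
  have su : sqint (fun x => A + B * (x - p) - prim (prim v) x).
    apply: cont_sqint => //; apply: contB.
      by apply: contD; [exact: cont_cst|exact: aff_cont].
    by apply: prim_cont => //; apply/integ_cont/prim_cont => //; exact: sqint_integ.
  rewrite !inner_reall//.
  move=> [E1 /oppr_inj E2]; rewrite E1 E2; split; apply: totalE => // x _.
    by rewrite lE.
  by rewrite lE.
split => //.
- by apply: kernel_necessary => // v A B sv Bc Br; have [] := K v A B sv Bc Br.
- by apply: kernel_necessary => // v A B sv Bc Br; have [] := K v A B sv Bc Br.
Qed.

End Domain.

(** * The equation f'' = - k^2 f *)

Section ComplexTrig.
Context {R : realType}.
Implicit Types (z w k : R[i]) (x y t : R) (f g : R -> R[i]).

Lemma der_eq (u : R -> R) x d e : is_derive x 1 u d -> d = e -> is_derive x 1 u e.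
Proof. by move=> ud <-. Qed.

Definition ch y : R := (expR y + expR (- y)) / 2.
Definition sh y : R := (expR y - expR (- y)) / 2.

Lemma ch2_sh2 y : ch y ^+ 2 - sh y ^+ 2 = 1.
Proof.
have e : expR y * expR (- y) = 1 by rewrite -expRD subrr expR0.
rewrite -[RHS]e /ch /sh; move: (expR y) (expR _) => u v; by field.
Qed.

Lemma ch_gt0 y : 0 < ch y.
Proof. by rewrite divr_gt0// addr_gt0 ?expR_gt0. Qed.

Lemma sh_eq0 y : sh y = 0 -> y = 0.
Proof.
move=> /eqP; rewrite mulf_eq0 invr_eq0 pnatr_eq0 orbF subr_eq0 => /eqP /expR_inj.
by move=> h; lra.
Qed.

Lemma chN y : ch (- y) = ch y.
Proof. by rewrite /ch opprK addrC. Qed.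

Lemma shN y : sh (- y) = - sh y.
Proof. by rewrite /sh opprK; field. Qed.

Lemma chD x y : ch (x + y) = ch x * ch y + sh x * sh y.
Proof. by rewrite /ch /sh opprD !expRD; move: (expR _) (expR _) (expR _) (expR _) => u v w z; field. Qed.

Lemma shD x y : sh (x + y) = sh x * ch y + ch x * sh y.
Proof. by rewrite /ch /sh opprD !expRD; move: (expR _) (expR _) (expR _) (expR _) => u v w z; field. Qed.

Lemma derNid x : is_derive x 1 (fun t => - t) (-1 : R).
Proof. by have := is_deriveNid x (1 : R). Qed.

Lemma derexpN x : is_derive x 1 (fun t => expR (- t)) (- expR (- x)).
Proof.
by have := der_comp (is_derive_expR (- x)) (derNid x); rewrite mulrN1.
Qed.

Lemma der_ch x : is_derive x 1 ch (sh x).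
Proof.
have := derZ 2^-1 (derD (is_derive_expR x) (derexpN x)).
rewrite (_ : (fun t => _) = ch); last by apply/funext => t; rewrite /ch mulrC.
by rewrite /sh mulrC.
Qed.

Lemma der_sh x : is_derive x 1 sh (ch x).
Proof.
have := derZ 2^-1 (derB (is_derive_expR x) (derexpN x)).
rewrite (_ : (fun t => _) = sh); last by apply/funext => t; rewrite /sh mulrC.
by rewrite /ch opprK mulrC.
Qed.

(** The classical expansion of the sine at [x + i y], with [ch] and [sh] the hyperbolic functions.
    It is differentiated only along lines [k (t - x0)] with [t] real. *)
Definition csin z : R[i] := (sin (Re z) * ch (Im z)) +i* (cos (Re z) * sh (Im z)).
Definition ccos z : R[i] := (cos (Re z) * ch (Im z)) +i* (- (sin (Re z) * sh (Im z))).

Lemma ccos2_csin2 z : ccos z * ccos z + csin z * csin z = 1.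
Proof.
case: z => x y; rewrite /ccos /csin /=; simpc.
have := ch2_sh2 y; have := cos2Dsin2 x.
move: (cos x) (sin x) (ch y) (sh y) => C S c s h1 h2.
apply/eqP; rewrite eq_complex /=; apply/andP; split; apply/eqP; last by ring.
transitivity ((C ^+ 2 + S ^+ 2) * (c ^+ 2 - s ^+ 2)); first by ring.
by rewrite h1 h2 mul1r.
Qed.

Lemma csinD z w : csin (z + w) = csin z * ccos w + ccos z * csin w.
Proof.
case: z w => x y [u v]; rewrite /ccos /csin /= sinD cosD chD shD; simpc.
by congr (_ +i* _); ring.
Qed.

Lemma ccosD z w : ccos (z + w) = ccos z * ccos w - csin z * csin w.
Proof.
case: z w => x y [u v]; rewrite /ccos /csin /= sinD cosD chD shD; simpc.
by congr (_ +i* _); ring.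
Qed.

Lemma csinN z : csin (- z) = - csin z.
Proof. by case: z => x y; rewrite /csin /= sinN cosN chN shN; simpc; congr (_ +i* _); ring. Qed.

Lemma csin0 : csin 0 = 0.
Proof. by rewrite /csin /= sin0 mul0r /sh oppr0 subrr mul0r mulr0. Qed.

Lemma ccos0 : ccos 0 = 1.
Proof. by rewrite /ccos /= cos0 sin0 !mul0r oppr0 /ch oppr0 expR0 mul1r divff. Qed.

Lemma csin_real x : csin x%:C = (sin x)%:C.
Proof. by rewrite /csin /= /sh /ch oppr0 subrr expR0 mul0r mulr0 divff// mulr1. Qed.

Lemma ccos_real x : ccos x%:C = (cos x)%:C.
Proof. by rewrite /ccos /= /sh /ch oppr0 subrr expR0 mul0r mulr0 oppr0 divff// mulr1. Qed.

(** As [ch] is positive, the real part gives [sin x = 0]; then [cos x] is nonzero and the imaginary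
    part gives [sh y = 0]. *)
Lemma csin_eq0 z : csin z = 0 -> Im z = 0 /\ sin (Re z) = 0.
Proof.
case: z => x y [/= sx0 cs0].
have s0 : sin x = 0.
  by move/eqP: sx0; rewrite mulf_eq0 (gt_eqF (ch_gt0 y)) orbF => /eqP.
split=> //; apply: sh_eq0; move/eqP: cs0; rewrite mulf_eq0 => /orP[/eqP c0|/eqP//].
by have := cos2Dsin2 x; rewrite c0 s0 expr0n /= addr0 => /eqP; rewrite eq_sym oner_eq0.
Qed.

Definition cder f x (d : R[i]) : Prop :=
  is_derive x 1 (fun t => Re (f t)) (Re d) /\ is_derive x 1 (fun t => Im (f t)) (Im d).

Lemma cderD f g x d e : cder f x d -> cder g x e -> cder (fun t => f t + g t) x (d + e).
Proof.
case: d e => d1 d2 [e1 e2] [/= f1 f2] [/= g1 g2]; split=> /=.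
  rewrite (_ : (fun t => _) = (fun t => Re (f t) + Re (g t))); first exact: derD.
  by apply/funext => t; case: (f t) (g t) => ? ? [].
rewrite (_ : (fun t => _) = (fun t => Im (f t) + Im (g t))); first exact: derD.
by apply/funext => t; case: (f t) (g t) => ? ? [].
Qed.

Lemma cderM f g x d e : cder f x d -> cder g x e ->
  cder (fun t => f t * g t) x (d * g x + f x * e).
Proof.
move=> [f1 f2] [g1 g2]; split=> /=.
  rewrite (_ : (fun t => _) = (fun t => Re (f t) * Re (g t) - Im (f t) * Im (g t))); last first.
    by apply/funext => t; case: (f t) (g t) => ? ? [].
  apply: (der_eq (derB (derM f1 g1) (derM f2 g2))).
  by case: (f x) (g x) d e {f1 f2 g1 g2} => ? ? [? ?] [? ?] [? ?] /=; ring.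
rewrite (_ : (fun t => _) = (fun t => Re (f t) * Im (g t) + Im (f t) * Re (g t))); last first.
  by apply/funext => t; case: (f t) (g t) => ? ? [].
apply: (der_eq (derD (derM f1 g2) (derM f2 g1))).
by case: (f x) (g x) d e {f1 f2 g1 g2} => ? ? [? ?] [? ?] [? ?] /=; ring.
Qed.

Lemma cder_cst z x : cder (fun=> z) x 0.
Proof. by split; exact: der_cst. Qed.

Lemma cderZ z f x d : cder f x d -> cder (fun t => z * f t) x (z * d).
Proof. by move=> fd; have := cderM (cder_cst z x) fd; rewrite mul0r add0r. Qed.

Lemma cder_csin k x0 x :
  cder (fun t => csin (k * (t - x0)%:C)) x (k * ccos (k * (x - x0)%:C)).
Proof.
case: k => u v.
have E t : (u +i* v) * (t - x0)%:C = (u * (t + - x0)) +i* (v * (t + - x0)).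
  by simpc.
have dS := der_comp_aff (is_derive_sin (u * (x + - x0))).
have dC := der_comp_aff (is_derive_cos (u * (x + - x0))).
have ds := der_comp_aff (der_sh (v * (x + - x0))).
have dc := der_comp_aff (der_ch (v * (x + - x0))).
split; rewrite E /csin /ccos /=.
  rewrite (_ : (fun t => _) = (fun t => sin (u * (t + - x0)) * ch (v * (t + - x0)))); last first.
    by apply/funext => t /=; rewrite !mulr0 subr0 add0r.
  by apply: (der_eq (derM dS dc)); ring.
rewrite (_ : (fun t => _) = (fun t => cos (u * (t + - x0)) * sh (v * (t + - x0)))); last first.
  by apply/funext => t /=; rewrite !mulr0 subr0 add0r.
by apply: (der_eq (derM dC ds)); ring.
Qed.

Lemma cder_ccos k x0 x :
  cder (fun t => ccos (k * (t - x0)%:C)) x (- (k * csin (k * (x - x0)%:C))).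
Proof.
case: k => u v.
have E t : (u +i* v) * (t - x0)%:C = (u * (t + - x0)) +i* (v * (t + - x0)).
  by simpc.
have dS := der_comp_aff (is_derive_sin (u * (x + - x0))).
have dC := der_comp_aff (is_derive_cos (u * (x + - x0))).
have ds := der_comp_aff (der_sh (v * (x + - x0))).
have dc := der_comp_aff (der_ch (v * (x + - x0))).
split; rewrite E /csin /ccos /=.
  rewrite (_ : (fun t => _) = (fun t => cos (u * (t + - x0)) * ch (v * (t + - x0)))); last first.
    by apply/funext => t /=; rewrite !mulr0 subr0 add0r.
  by apply: (der_eq (derM dC dc)); ring.
rewrite (_ : (fun t => _) = (fun t => (-1) * (sin (u * (t + - x0)) * sh (v * (t + - x0))))); last first.
  by apply/funext => t /=; rewrite !mulr0 subr0 add0r mulN1r.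
by apply: (der_eq (derZ (-1) (derM dS ds))); ring.
Qed.

Definition ccont (b e : R) f : Prop :=
  cont b e (fun t => Re (f t)) /\ cont b e (fun t => Im (f t)).

Lemma ccontM b e f g : ccont b e f -> ccont b e g -> ccont b e (fun t => f t * g t).
Proof.
move=> [f1 f2] [g1 g2]; split.
  rewrite (_ : (fun t => _) = (fun t => Re (f t) * Re (g t) - Im (f t) * Im (g t))); last first.
    by apply/funext => t; case: (f t) (g t) => ? ? [].
  by apply: contB; exact: contM.
rewrite (_ : (fun t => _) = (fun t => Re (f t) * Im (g t) + Im (f t) * Re (g t))); last first.
  by apply/funext => t; case: (f t) (g t) => ? ? [].
by apply: contD; exact: contM.
Qed.

Lemma ccontD b e f g : ccont b e f -> ccont b e g -> ccont b e (fun t => f t + g t).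
Proof.
move=> [f1 f2] [g1 g2]; split.
  rewrite (_ : (fun t => _) = (fun t => Re (f t) + Re (g t))); last first.
    by apply/funext => t; case: (f t) (g t) => ? ? [].
  exact: contD.
rewrite (_ : (fun t => _) = (fun t => Im (f t) + Im (g t))); last first.
  by apply/funext => t; case: (f t) (g t) => ? ? [].
exact: contD.
Qed.

Lemma ccont_cst b e z : ccont b e (fun=> z).
Proof. by split; exact: cont_cst. Qed.

Lemma cder_ccont b e f f' : (forall x, cder f x (f' x)) -> ccont b e f.
Proof.
move=> h; split; apply: cont_continuous => x; have [d1 d2] := h x.
  exact: der_continuous d1.
exact: der_continuous d2.
Qed.

Lemma cder0_cst b e f : ccont b e f -> (forall x, b < x < e -> cder f x 0) ->
  forall x y, b <= x <= e -> b <= y <= e -> f x = f y.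
Proof.
move=> [c1 c2] h.
have E (g : R -> R) : cont b e g -> (forall x, b < x < e -> is_derive x 1 g 0) ->
    forall x, b <= x <= e -> g x = g b.
  move=> cg dg x /andP[bx xe]; apply/eqP; rewrite -subr_eq0; apply/eqP.
  have E : prim b (fun=> 0) x = g x - g b.
    apply: prim_FTC => //; [exact: cont_cst|exact: contS cg|].
    by move=> y /andP[by_ yx]; apply: dg; rewrite by_ (lt_le_trans yx).
  by rewrite -E prim_cst ?mul0r.
move=> x y xI yI.
have E1 := E _ c1 (fun x xI => (h x xI).1).
have E2 := E _ c2 (fun x xI => (h x xI).2).
have [h1 h2] := (E1 x xI, E2 x xI); have [h3 h4] := (E1 y yI, E2 y yI).
by apply/eqP; rewrite eq_complex h1 h2 h3 h4 !eqxx.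
Qed.

(* [k f ccos - g csin] and [k f csin + g ccos] are constant. *)
Lemma oscillator_unique k b e x0 f g : k != 0 ->
  ccont b e f -> ccont b e g ->
  (forall x, b < x < e -> cder f x (g x)) ->
  (forall x, b < x < e -> cder g x (- (k * k * f x))) ->
  b <= x0 <= e -> f x0 = 0 -> forall x, b <= x <= e ->
  f x = g x0 / k * csin (k * (x - x0)%:C) /\ g x = g x0 * ccos (k * (x - x0)%:C).
Proof.
move=> k0 cf cg df dg x0I f0.
pose C t := ccos (k * (t - x0)%:C); pose S t := csin (k * (t - x0)%:C).
have dC x : cder C x (- (k * S x)) by exact: cder_ccos.
have dS x : cder S x (k * C x) by exact: cder_csin.
have cC : ccont b e C by exact: cder_ccont dC.
have cS : ccont b e S by exact: cder_ccont dS.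
pose U t := k * (f t * C t) + (-1) * (g t * S t).
pose V t := k * (f t * S t) + g t * C t.
have cU : ccont b e U.
  by apply: ccontD; apply: ccontM; [exact: ccont_cst|exact: ccontM|exact: ccont_cst|exact: ccontM].
have cV : ccont b e V.
  by apply: ccontD; apply: ccontM => //; [exact: ccont_cst|exact: ccontM].
have dU x : b < x < e -> cder U x 0.
  move=> xI; have := cderD (cderZ k (cderM (df x xI) (dC x))) (cderZ (-1) (cderM (dg x xI) (dS x))).
  by move: (C x) (S x) => c s; rewrite [X in cder _ _ X](_ : _ = 0)//; ring.
have dV x : b < x < e -> cder V x 0.
  move=> xI; have := cderD (cderZ k (cderM (df x xI) (dS x))) (cderM (dg x xI) (dC x)).
  by move: (C x) (S x) => c s; rewrite [X in cder _ _ X](_ : _ = 0)//; ring.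
move=> x xI.
have S0 : S x0 = 0 by rewrite /S subrr mulr0 csin0.
have C0 : C x0 = 1 by rewrite /C subrr mulr0 ccos0.
have Ux : U x = 0.
  by rewrite (cder0_cst cU dU xI x0I) /U f0 S0 !(mul0r, mulr0) addr0.
have Vx : V x = g x0.
  by rewrite (cder0_cst cV dV xI x0I) /V f0 C0 mul0r mulr0 add0r mulr1.
have CS : C x * C x + S x * S x = 1 by exact: ccos2_csin2.
(* The equations [U = 0] and [V = g x0] form a linear system for [k f] and [g], of determinant
   [c^2 + s^2 = 1]. *)
move: Ux Vx CS; rewrite /U /V -/(C x) -/(S x); move: (C x) (S x) => c s Ux Vx CS.
split.
  have E : k * f x = g x0 * s.
    rewrite -Vx -[LHS]mulr1 -CS.
    apply/eqP; rewrite -subr_eq0; apply/eqP.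
    by rewrite -[RHS](mulr0 c) -Ux; ring.
  by rewrite mulrAC -E mulrAC divff// mul1r.
rewrite -Vx -[LHS]mulr1 -CS; apply/eqP; rewrite -subr_eq0; apply/eqP.
by rewrite -[RHS](mulr0 (- s)) -Ux; ring.
Qed.

End ComplexTrig.

(** * Eigenspaces *)

Section PrimAfter.
Context {R : realType} (p r c : R).
Hypotheses (pc : p < c) (cr : c < r).

Lemma prim_after_left x : p <= x <= c -> prim p (after c) x = 0.
Proof.
move=> /andP[px xc]; rewrite (@primE _ p x _ (fun=> 0)) ?prim_cst ?mul0r ?px ?lexx//.
by move=> t /andP[_ tx]; rewrite /after ltNge (le_trans tx xc).
Qed.

Lemma prim_after_right x : c <= x <= r -> prim p (after c) x = x - c.
Proof.
rewrite le_eqVlt => /andP[/predU1P[<- _|cx xr]].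
  by rewrite prim_after_left ?subrr// lexx ltW.
exact: (prim_after_r pc cx).
Qed.

(** The right-hand side [q] is controlled only almost everywhere. A continuous [Q] with the same
    primitive makes [prim p Q] differentiable in turn, so the equation holds classically on both
    sides of [c]. *)
Lemma kernel_fun_der (f q Q : R -> R) al J :
  (forall x, f x = al * (x - p) + J * prim p (after c) x - prim p (prim p q) x) ->
  cont p r Q -> (forall t, p <= t <= r -> prim p q t = prim p Q t) ->
  (forall x, p < x < c -> is_derive x 1 f (al - prim p Q x)) /\
  (forall x, c < x < r -> is_derive x 1 f (al + J - prim p Q x)).
Proof.
move=> fE cQ qQ; have pr : p < r := lt_trans pc cr.
have cPQ : cont p r (prim p Q) by apply: prim_cont => //; exact: integ_cont.
have PPQ y : p <= y <= r -> prim p (prim p q) y = prim p (prim p Q) y.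
  by move=> yI; exact: primE qQ.
split=> x /andP[x1 x2].
  have xI : p < x < r by rewrite x1 (lt_trans x2).
  have d := derB (der_aff al (- p) x) (prim_derive pr cPQ xI).
  apply: near_eq_is_derive d; near=> y.
  have py : p <= y by apply: ltW; near: y; exact: lt_nbhsr.
  have yc : y <= c by apply: ltW; near: y; exact: lt_nbhsl.
  by rewrite fE prim_after_left ?PPQ ?py ?yc ?mulr0 ?addr0// (le_trans yc) ?ltW.
have xI : p < x < r by rewrite x2 (lt_trans pc).
have d := derB (derD (der_aff al (- p) x) (der_aff J (- c) x)) (prim_derive pr cPQ xI).
apply: near_eq_is_derive d; near=> y.
have cy : c <= y by apply: ltW; near: y; exact: lt_nbhsr.
have yr : y <= r by apply: ltW; near: y; exact: lt_nbhsl.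
by rewrite fE prim_after_right ?PPQ ?cy ?yr// (le_trans (ltW pc)).
Unshelve. all: by end_near. Qed.

(** The clause on [Q] is quantified after [f] because, for complex [lam], the appropriate [Q] is
    built from the representatives of both components. *)
Lemma kernel_component (w q : R -> R) al J : sqint p r q ->
  eqae p r w (fun x => al * (x - p) + J * prim p (after c) x - prim p (prim p q) x) ->
  al * (r - p) + J * prim p (after c) r - prim p (prim p q) r = 0 ->
  exists f : R -> R, [/\ eqae p r w f, cont p r f, f p = 0, f r = 0 &
    forall Q, cont p r Q -> (forall t, p <= t <= r -> prim p q t = prim p Q t) ->
      (forall x, p < x < c -> is_derive x 1 f (al - prim p Q x)) /\
      (forall x, c < x < r -> is_derive x 1 f (al + J - prim p Q x))].
Proof.
move=> sq E Z; have pr : p < r := lt_trans pc cr.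
exists (fun x => al * (x - p) + J * prim p (after c) x - prim p (prim p q) x).
split; [exact: E| | |exact: Z|].
- apply: contB.
    by apply: contD; [exact: aff_cont|apply: contZ; apply: prim_cont => //; exact: after_integ].
  by apply: prim_cont => //; apply: integ_cont; apply: prim_cont => //; exact: sqint_integ.
- by rewrite !prim0 subrr !mulr0 addr0 subr0.
- by move=> Q; exact: kernel_fun_der.
Qed.

(** [G1] and [G2] are the primitives of the components of [lam psi]; their vanishing at [r] is the
    mean-zero condition. The amplitudes are the derivatives at the outer endpoints, divided by
    [k]. *)
Lemma oscillator_pair (lam k : R[i]) (f1 f2 G1 G2 : R -> R) al1 J1 al2 J2 :
  k != 0 -> k * k = lam ->
  cont p r f1 -> cont p r f2 -> cont p r G1 -> cont p r G2 ->
  G1 p = 0 -> G2 p = 0 -> G1 r = 0 -> G2 r = 0 ->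
  f1 p = 0 -> f2 p = 0 -> f1 r = 0 -> f2 r = 0 ->
  (forall x, p < x < r -> is_derive x 1 G1 (Re lam * f1 x - Im lam * f2 x)) ->
  (forall x, p < x < r -> is_derive x 1 G2 (Re lam * f2 x + Im lam * f1 x)) ->
  (forall x, p < x < c -> is_derive x 1 f1 (al1 - G1 x)) ->
  (forall x, p < x < c -> is_derive x 1 f2 (al2 - G2 x)) ->
  (forall x, c < x < r -> is_derive x 1 f1 (al1 + J1 - G1 x)) ->
  (forall x, c < x < r -> is_derive x 1 f2 (al2 + J2 - G2 x)) ->
  exists A B : R[i],
    [/\ (forall x, p <= x <= r -> (f1 x) +i* (f2 x) =
          if x < c then A * csin (k * (x - p)%:C) else B * csin (k * (x - r)%:C)),
        A * csin (k * (c - p)%:C) = B * csin (k * (c - r)%:C) &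
        A * (ccos (k * (c - p)%:C) - 1) = B * (ccos (k * (c - r)%:C) - 1)].
Proof.
move=> k0 kk cf1 cf2 cG1 cG2 G1p G2p G1r G2r f1p f2p f1r f2r dG1 dG2 df1l df2l df1r df2r.
pose F x : R[i] := (f1 x) +i* (f2 x).
pose gl x : R[i] := (al1 - G1 x) +i* (al2 - G2 x).
pose gr x : R[i] := (al1 + J1 - G1 x) +i* (al2 + J2 - G2 x).
have QF x : - (k * k * F x) =
    (0 - (Re lam * f1 x - Im lam * f2 x)) +i* (0 - (Re lam * f2 x + Im lam * f1 x)).
  rewrite kk /F; move: (f1 x) (f2 x) => y z.
  by case: (lam) => l1 l2; simpc; congr (_ +i* _); ring.
have cFl : ccont p c F by split; apply: (contS (lexx p) (ltW cr)).
have cFr : ccont c r F by split; apply: (contS (ltW pc) (lexx r)).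
have cgl : ccont p c gl.
  by split; apply: (contS (lexx p) (ltW cr)); apply: contB => //; exact: cont_cst.
have cgr : ccont c r gr.
  by split; apply: (contS (ltW pc) (lexx r)); apply: contB => //; exact: cont_cst.
have Fp : F p = 0 by rewrite /F f1p f2p.
have Fr : F r = 0 by rewrite /F f1r f2r.
have dFl x : p < x < c -> cder F x (gl x) by move=> xI; split; [exact: df1l|exact: df2l].
have dFr x : c < x < r -> cder F x (gr x) by move=> xI; split; [exact: df1r|exact: df2r].
have dgl x : p < x < c -> cder gl x (- (k * k * F x)).
  move=> /andP[px xc]; have xI : p < x < r by rewrite px (lt_trans xc).
  rewrite QF; split; apply: derB.
  - exact: dG1.
  - exact: dG2.
have dgr x : c < x < r -> cder gr x (- (k * k * F x)).
  move=> /andP[cx xr]; have xI : p < x < r by rewrite xr (lt_trans pc).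
  rewrite QF; split; apply: derB.
  - exact: dG1.
  - exact: dG2.
have pI : p <= p <= c by rewrite lexx ltW.
have rI : c <= r <= r by rewrite lexx ltW.
have cIl : p <= c <= c by rewrite lexx ltW.
have cIr : c <= c <= r by rewrite lexx ltW.
have L := oscillator_unique k0 cFl cgl dFl dgl pI Fp.
have Rt := oscillator_unique k0 cFr cgr dFr dgr rI Fr.
have [L1 L2] := L c cIl; have [R1 R2] := Rt c cIr.
exists (gl p / k), (gr r / k); split.
- move=> x /andP[px xr]; rewrite -/(F x); case: (ltP x c) => xc.
    by have [] := L x; rewrite ?px ?ltW.
  by have [] := Rt x; rewrite ?xc ?xr.
- by rewrite -L1 -R1.
(* Both sides are the change of the derivative from the outer endpoint to [c], over [k]. Since [G1]
   and [G2] vanish at both ends, each change is minus the value of [G1 + i G2] at [c], and the jump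
   drops out. *)
- rewrite !(mulrAC _ k^-1); congr (_ / k).
  rewrite !mulrBr !mulr1 -L2 -R2 /gl /gr G1p G2p G1r G2r.
  by simpc; congr (_ +i* _); ring.
Qed.

End PrimAfter.

(** * The general form of an eigenfunction and the reality of its frequency *)

Section EigenForm.
Context {R : realType} (a : R).
Hypotheses (a_gtN1 : -1 < a) (a_lt1 : a < 1).
Local Notation p := (- (pi / 2) : R).
Local Notation r := (pi / 2 : R).
Local Notation c := (pi / 2 * a : R).
Implicit Types (u v w q : R -> R) (psi : R -> R[i]) (lam k : R[i]).

Let pc := left_lt a_gtN1.
Let cr := right_lt a_lt1.
Let pr : p < r. Proof. exact: lt_trans pc cr. Qed.

Lemma eigenspace_form lam k psi : k != 0 -> k * k = lam ->
  eigenspace_of (adjoint I0 (H a)) lam psi ->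
  exists A B : R[i],
    [/\ eq_ae I0 psi (fun x => if x < c then A * csin (k * (x - p)%:C) else B * csin (k * (x - r)%:C)),
        A * csin (k * (c - p)%:C) = B * csin (k * (c - r)%:C) &
        A * (ccos (k * (c - p)%:C) - 1) = B * (ccos (k * (c - r)%:C) - 1)].
Proof.
move=> k0 kk /(adjoint_structure a_gtN1 a_lt1) /=.
set q1 := (fun x => Re lam * Re (psi x) - _); set q2 := (fun x => Re lam * Im (psi x) + _).
move=> [sR sI [t1 [al1 [J1 [E1 Z1]]]] [t2 [al2 [J2 [E2 Z2]]]]].
have s1 : sqint p r q1 by apply: sqintB; exact: sqintZ.
have s2 : sqint p r q2 by apply: sqintD; exact: sqintZ.
have [f1 [{}E1 cf1 f1p f1r D1]] := kernel_component pc cr s1 E1 Z1.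
have [f2 [{}E2 cf2 f2p f2r D2]] := kernel_component pc cr s2 E2 Z2.
clear Z1 Z2.
(* Continuous representatives of the two components of [lam psi]. *)
have [Q1 Q1E] : exists Q1, forall x, Q1 x = Re lam * f1 x - Im lam * f2 x by eexists.
have [Q2 Q2E] : exists Q2, forall x, Q2 x = Re lam * f2 x + Im lam * f1 x by eexists.
have cQ1 : cont p r Q1 by rewrite (funext Q1E); apply: contB; exact: contZ.
have cQ2 : cont p r Q2 by rewrite (funext Q2E); apply: contD; exact: contZ.
have P1 x : p <= x <= r -> prim p q1 x = prim p Q1 x.
  move=> xI; apply: (eqae_prim xI); [exact: sqint_integ|exact: integ_cont|].
  by apply: filterS2 E1 E2 => y /= e1 e2 yI; rewrite Q1E /q1 e1// e2.
have P2 x : p <= x <= r -> prim p q2 x = prim p Q2 x.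
  move=> xI; apply: (eqae_prim xI); [exact: sqint_integ|exact: integ_cont|].
  by apply: filterS2 E1 E2 => y /= e1 e2 yI; rewrite Q2E /q2 e1// e2.
have [df1l df1r] := D1 Q1 cQ1 P1.
have [df2l df2r] := D2 Q2 cQ2 P2.
have rI : p <= r <= r by rewrite ltW ?lexx.
have G1r : prim p Q1 r = 0 by rewrite -P1.
have G2r : prim p Q2 r = 0 by rewrite -P2.
have cG1 : cont p r (prim p Q1) by apply: prim_cont => //; exact: integ_cont.
have cG2 : cont p r (prim p Q2) by apply: prim_cont => //; exact: integ_cont.
have dG1 x : p < x < r -> is_derive x 1 (prim p Q1) (Re lam * f1 x - Im lam * f2 x).
  by move=> xI; rewrite -Q1E; exact: (prim_derive pr cQ1 xI).
have dG2 x : p < x < r -> is_derive x 1 (prim p Q2) (Re lam * f2 x + Im lam * f1 x).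
  by move=> xI; rewrite -Q2E; exact: (prim_derive pr cQ2 xI).
have [A [B [E C1 C2]]] := oscillator_pair pc cr k0 kk cf1 cf2 cG1 cG2 (prim0 p _) (prim0 p _)
  G1r G2r f1p f2p f1r f2r dG1 dG2 df1l df2l df1r df2r.
exists A, B; split=> //.
apply: filterS2 E1 E2 => x /= e1 e2 xI.
rewrite -E; last by move: xI; rewrite /I0 /= in_itv /= => /andP[/ltW -> /ltW ->].
by rewrite -e1// -e2//; case: (psi x).
Qed.

(* Half the lengths of the two subintervals: both matching conditions factor
   through half angles. *)
Definition half_left : R := pi * (1 + a) / 4.
Definition half_right : R := pi * (1 - a) / 4.

Lemma half_left_gt0 : 0 < half_left.
Proof. by rewrite divr_gt0// mulr_gt0 ?pi_gt0// -ltrBlDl sub0r. Qed.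

Lemma half_right_gt0 : 0 < half_right.
Proof. by rewrite divr_gt0// mulr_gt0 ?pi_gt0// subr_gt0. Qed.

(** Duplication formulas: [sin 2t = 2 sin t cos t] and [cos 2t - 1 = - 2 sin^2 t]. The sign in the
    first relation appears because [c - r] is minus twice [half_right]. *)
Lemma half_angles k (A B : R[i]) :
  A * csin (k * (c - p)%:C) = B * csin (k * (c - r)%:C) ->
  A * (ccos (k * (c - p)%:C) - 1) = B * (ccos (k * (c - r)%:C) - 1) ->
  A * (csin (k * half_left%:C) * ccos (k * half_left%:C)) = - (B * (csin (k * half_right%:C) * ccos (k * half_right%:C))) /\
  A * csin (k * half_left%:C) ^+ 2 = B * csin (k * half_right%:C) ^+ 2.
Proof.
have E1 : k * (c - p)%:C = k * half_left%:C + k * half_left%:C.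
  by case: (k) => u v; simpc; congr (_ +i* _); rewrite /half_left; field.
have E2 : k * (c - r)%:C = - (k * half_right%:C + k * half_right%:C).
  by case: (k) => u v; simpc; congr (_ +i* _); rewrite /half_right; field.
have ccosN z : ccos (- z) = ccos z :> R[i].
  by case: z => x y; rewrite /ccos /= sinN cosN chN shN; congr (_ +i* _); ring.
rewrite E1 E2 csinN ccosN !csinD !ccosD.
have := ccos2_csin2 (k * half_left%:C); have := ccos2_csin2 (k * half_right%:C).
move: (csin _) (ccos _) (csin _) (ccos _) => s2 c2 s1 c1 e2 e1 F1 F2.
have n2 : (2 : R[i]) != 0 by rewrite pnatr_eq0.
split; apply: (mulfI n2).
  by apply: etrans (etrans F1 _); ring.
apply: oppr_inj; apply: etrans (etrans F2 _).
  by rewrite -[X in _ - X]e1; ring.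
by rewrite -[X in _ - X]e2; ring.
Qed.

Lemma eigenvalue_real lam psi : eigenfunction I0 (adjoint I0 (H a)) lam psi -> lam != 0 ->
  exists2 k : R, 0 < k & lam = (k ^+ 2)%:C.
Proof.
move=> [Epsi npsi] lam0; pose k := sqrtc lam.
have kk : k * k = lam by rewrite -expr2 sqr_sqrtc.
have k0 : k != 0 by apply: contra_neq lam0 => k0; rewrite -kk k0 mul0r.
have [A [B [psiE C1 C2]]] := eigenspace_form k0 kk Epsi.
have [F1 F2] := half_angles C1 C2.
have AB : ~ (A = 0 /\ B = 0).
  move=> [A0 B0]; apply: npsi; apply: filterS psiE => x /= + xI => /(_ xI) ->.
  by rewrite A0 B0 !mul0r; case: ifP.
have h10 := half_left_gt0; have h20 := half_right_gt0.
have [t t0 kt] : exists2 t : R, 0 < t & csin (k * t%:C) = 0.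
  have [s10|s10] := eqVneq (csin (k * half_left%:C)) 0; first by exists half_left.
  have [s20|s20] := eqVneq (csin (k * half_right%:C)) 0; first by exists half_right.
  exists (half_left + half_right); first exact: addr_gt0.
  rewrite rmorphD mulrDr csinD.
  move: F1 F2 s10 s20; move: (csin _) (ccos _) (csin _) (ccos _) => s2 c2 s1 c1.
  move=> F1 F2 s10 s20; have A0 : A != 0.
    apply/eqP => A0; apply: AB; split => //; move/eqP: F2.
    by rewrite A0 mul0r eq_sym mulf_eq0 expf_eq0 (negbTE s20) orbF => /eqP.
  apply: (mulfI (mulf_neq0 A0 s10)); rewrite mulr0.
  (* Elimination of [B]: the two relations turn these terms into [c2 B s2^2 - s2 B s2 c2]. *)
  transitivity (c2 * (A * s1 ^+ 2) + s2 * (A * (s1 * c1))); first by ring.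
  by rewrite F1 F2; ring.
have [Imk _] := csin_eq0 kt.
have Ik : Im k = 0.
  move: Imk; case: (k) => u v /=; rewrite mulr0 add0r => /eqP.
  by rewrite mulf_eq0 (gt_eqF t0) orbF => /eqP.
have kR : k = (Re k)%:C by move: Ik; case: (k) => u v /= ->.
(* The sign of the chosen square root [k] is arbitrary, hence the absolute value. *)
exists `|Re k|; last by rewrite real_normK ?num_real// rmorphXn /= -kR expr2 kk.
by rewrite normr_gt0; apply: contra_neq k0 => Rk0; rewrite kR Rk0.
Qed.

End EigenForm.

(** * Primitives of functions given by two formulas *)

Section PiecewisePrimitive.
Context {R : realType} (p r c : R).
Hypotheses (pc : p < c) (cr : c < r).

Lemma piecewise_prim (F1 F2 f1 f2 w : R -> R) :
  (forall x : R, is_derive x 1 F1 (f1 x)) -> (forall x : R, is_derive x 1 F2 (f2 x)) ->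
  continuous f1 -> continuous f2 ->
  (forall x, w x = if c < x then f2 x else f1 x) ->
  integ p r w /\
  (forall x, p <= x <= r -> prim p w x =
    if c < x then F1 c - F1 p + (F2 x - F2 c) else F1 x - F1 p).
Proof.
move=> dF1 dF2 cf1 cf2 wE; have pr : p < r := lt_trans pc cr.
have iw : integ p r w.
  rewrite (_ : w = fun x => f1 x + (f2 x - f1 x) * after c x); last first.
    by apply/funext => x; rewrite wE /after; case: ifP => _; rewrite ?mulr1 ?mulr0 ?addr0 ?subrKC.
  apply: integD; first by apply: integ_cont; exact: cont_continuous.
  apply: sqintM; last exact: after_sqint.
  by apply: cont_sqint => //; apply: contB; exact: cont_continuous.
have FTC (F f : R -> R) b e : b <= e -> (forall x : R, is_derive x 1 F (f x)) -> continuous f ->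
    prim b f e = F e - F b.
  move=> be dF cf; apply: prim_FTC => //; first exact: cont_continuous.
  by apply: cont_continuous => y; have d := dF y; exact: (der_continuous d).
split=> // x /andP[px xr].
have left y : p <= y <= c -> prim p w y = F1 y - F1 p.
  move=> /andP[py yc]; rewrite -(FTC _ f1 _ _ py dF1 cf1).
  apply: (@primE _ p y); first by rewrite py lexx.
  by move=> t /andP[_ ty]; rewrite wE ltNge (le_trans ty yc).
case: ltP => cx; last by rewrite left ?px.
have cI : p <= c <= x by rewrite !ltW.
rewrite (prim_split cI); last exact: (integSS (lexx p) xr iw).
rewrite left ?lexx ?ltW//; congr (_ + _).
rewrite -(FTC _ f2 _ _ (ltW cx) dF2 cf2).
apply: (@eqae_prim _ c x).
- by rewrite lexx ltW.
- exact: (integSS (ltW pc) xr iw).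
- by apply: integ_cont; exact: cont_continuous.
- by apply: aeW => t /=; rewrite in_itv /= => /andP[ct _]; rewrite wE ct.
Qed.

End PiecewisePrimitive.

(** * The explicit eigenfunctions *)

Section Eigenfunctions.
Context {R : realType} (a : R).
Hypotheses (a_gtN1 : -1 < a) (a_lt1 : a < 1).
Local Notation p := (- (pi / 2) : R).
Local Notation r := (pi / 2 : R).
Local Notation c := (pi / 2 * a : R).
Implicit Types (psi : R -> R[i]) (A B : R[i]).

Let pc := left_lt a_gtN1.
Let cr := right_lt a_lt1.
Let pr : p < r. Proof. exact: lt_trans pc cr. Qed.

(** The last two hypotheses are the equation [- F'' = lam F] integrated once from the outer endpoint
    of each side, with [f1], [f2] the derivatives and [P1], [P2] antiderivatives of the two
    pieces. *)
Lemma eigen_intro (lam : R) (F1 F2 f1 f2 P1 P2 : R -> R) :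
  (forall x : R, is_derive x 1 F1 (f1 x)) -> (forall x : R, is_derive x 1 F2 (f2 x)) ->
  (forall x : R, is_derive x 1 P1 (F1 x)) -> (forall x : R, is_derive x 1 P2 (F2 x)) ->
  continuous f1 -> continuous f2 ->
  F1 p = 0 -> F1 c = F2 c -> F2 r = 0 ->
  lam * (P1 c - P1 p + (P2 r - P2 c)) = 0 ->
  (forall x, f1 x = f1 p - lam * (P1 x - P1 p)) ->
  (forall x, f2 x = f2 r - lam * (P2 x - P2 r)) ->
  eigenspace_of (adjoint I0 (H a)) lam%:C (piecewise a F1 F2).
Proof.
move=> dF1 dF2 dP1 dP2 cf1 cf2 F1p F1c F2r tot f1E f2E.
have cF1 : continuous F1 by move=> x; have d := dF1 x; exact: (der_continuous d).
have cF2 : continuous F2 by move=> x; have d := dF2 x; exact: (der_continuous d).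
pose psi x := if c < x then F2 x else F1 x.
have -> : piecewise a F1 F2 = (fun x => (psi x)%:C).
  (* At [c] itself [piecewise] takes the right formula and [psi] the left one; continuity reconciles
     them. *)
  by apply/funext => x; rewrite /piecewise /psi; case: ltgtP => // ->; rewrite F1c.
pose w1 x := if c < x then f2 x else f1 x.
have [iw1 w1E] := piecewise_prim pc cr dF1 dF2 cf1 cf2 (fun x => erefl (w1 x)).
have [ipsi psiE] := piecewise_prim pc cr dP1 dP2 cF1 cF2 (fun x => erefl (psi x)).
have psiw x : p <= x <= r -> psi x = prim p w1 x.
  by move=> xI; rewrite w1E// /psi; case: ifP => _; rewrite F1p ?F1c; ring.
have rI : p <= r <= r by rewrite lexx ltW.
(* This [J] is the jump [f2 c - f1 c], expressed by the integrated equations. *)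
apply: (adjoint_real a_gtN1 a_lt1 (w1 := w1) (al := f1 p)
  (J := f2 r - f1 p - lam * (P2 c - P2 r) + lam * (P1 c - P1 p))).
- have cpsi : cont p r (prim p w1) by exact: prim_cont.
  have [m1 i1] := cont_sqint cpsi.
  have e : {in [set` `[p, r]], prim p w1 =1 psi}.
    by move=> x; rewrite inE /= in_itv /= => xI; rewrite psiw.
  split; first exact: (eq_measurable_fun _ e m1).
  apply: (eq_integrable _ _ _ _ i1) => //= x xI; by rewrite e.
- exact: iw1.
- exact: psiw.
- by rewrite /psi cr.
- move=> x xI; rewrite psiE// /w1 /after; case: ifP => _.
    by rewrite (f2E x) (_ : true%:R = 1)//; ring.
  by rewrite (f1E x) mulr0 addr0.
- by rewrite /total psiE// cr.
Qed.

Lemma cosD2 (x : R) : cos (x + x) = 1 - 2 * sin x ^+ 2.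
Proof. by rewrite cosD; have := cos2Dsin2 x; move: (cos x) (sin x) => C S h; nra. Qed.

Lemma sinD2 (x : R) : sin (x + x) = 2 * (sin x * cos x).
Proof. by rewrite sinD; ring. Qed.

(** The converse of [half_angles]: the first relation is continuity at the corner, the second is
    mean zero. *)
Lemma oscillating_eigen (k A B : R) : 0 < k ->
  A * (sin (k * half_left a) * cos (k * half_left a)) =
    - (B * (sin (k * half_right a) * cos (k * half_right a))) ->
  A * sin (k * half_left a) ^+ 2 = B * sin (k * half_right a) ^+ 2 ->
  eigenspace_of (adjoint I0 (H a)) (k ^+ 2)%:C
    (piecewise a (fun x => A * sin (k * (x + pi / 2))) (fun x => B * sin (k * (x - pi / 2)))).
Proof.
move=> k0 E1 E2; have kn0 : k != 0 by rewrite gt_eqF.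
have dS (D e x : R) : is_derive x 1 (fun t => D * sin (k * (t + e))) (D * (k * cos (k * (x + e)))).
  by apply: derZ; apply: der_comp_aff; exact: is_derive_sin.
have dC (D e x : R) : is_derive x 1 (fun t => (- D / k) * cos (k * (t + e))) (D * sin (k * (x + e))).
  apply: (der_eq (derZ (- D / k) (der_comp_aff (is_derive_cos (k * (x + e)))))).
  by move: (sin _) => S; field.
have dK (D e x : R) : is_derive x 1 (fun t => D * (k * cos (k * (t + e)))) (D * (k * (k * - sin (k * (x + e))))).
  by apply: derZ; apply: derZ; apply: der_comp_aff; exact: is_derive_cos.
have kl : k * (c + pi / 2) = k * half_left a + k * half_left a by rewrite /half_left; field.
have kr : k * (c + - (pi / 2)) = - (k * half_right a + k * half_right a) by rewrite /half_right; field.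
apply: (eigen_intro (f1 := fun x => A * (k * cos (k * (x + pi / 2))))
  (f2 := fun x => B * (k * cos (k * (x - pi / 2))))
  (P1 := fun t => (- A / k) * cos (k * (t + pi / 2)))
  (P2 := fun t => (- B / k) * cos (k * (t - pi / 2)))).
- by move=> x; have d := dK A (pi / 2) x; exact: (der_continuous d).
- by move=> x; have d := dK B (- (pi / 2)) x; exact: (der_continuous d).
- by rewrite addNr mulr0 sin0 mulr0.
- by rewrite kl kr sinN !sinD2; move: E1; move: (sin _) (cos _) (sin _) (cos _) => s1 c1 s2 c2 E1; lra.
- by rewrite subrr mulr0 sin0 mulr0.
- rewrite addNr subrr mulr0 cos0 kl kr cosN !cosD2.
  move: E2; move: (sin _) (sin _) => s2 s1 E2.
  transitivity (2 * k * (A * s1 ^+ 2 - B * s2 ^+ 2)); first by field.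
  by rewrite E2 subrr mulr0.
- move=> x; rewrite addNr mulr0 cos0; move: (cos _) => C; by field.
- move=> x; rewrite subrr mulr0 cos0; move: (cos _) => C; by field.
Qed.

(** The slopes [a - 1] and [a + 1] give both pieces the value [(a^2 - 1) pi / 2] at the corner. For
    [lam = 0] the mean-zero condition is void. *)
Lemma affine_eigen : eigenspace_of (adjoint I0 (H a)) 0 (phi_affine a).
Proof.
have dA (e D x : R) : is_derive x 1 (fun t => D * (t + e)) D by exact: der_aff.
have dP (e D x : R) : is_derive x 1 (fun t => D / 2 * ((t + e) * (t + e))) (D * (x + e)).
  have d : is_derive x 1 (fun t => t + e) 1.
    by have := der_aff 1 e x; rewrite (_ : (fun t => _) = (fun t => t + e)) //; apply/funext => t; rewrite mul1r.
  by apply: (der_eq (derZ (D / 2) (derM d d))); field.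
apply: (@eigen_intro 0 _ _ (fun=> a - 1) (fun=> a + 1)
  (fun t => (a - 1) / 2 * ((t + pi / 2) * (t + pi / 2)))
  (fun t => (a + 1) / 2 * ((t - pi / 2) * (t - pi / 2)))).
- exact: cst_continuous.
- exact: cst_continuous.
- by rewrite addNr mulr0.
- by ring.
- by rewrite subrr mulr0.
- by rewrite mul0r.
- by move=> x; rewrite mul0r subr0.
- by move=> x; rewrite mul0r subr0.
Qed.

Lemma eigenspace_pos (k : R) psi : 0 < k ->
  eigenspace_of (adjoint I0 (H a)) (k ^+ 2)%:C psi ->
  exists A B, [/\ eq_ae I0 psi (fun x => A * phi_left a k x + B * phi_right a k x),
    A * (sin (k * half_left a) * cos (k * half_left a))%:C =
      - (B * (sin (k * half_right a) * cos (k * half_right a))%:C) &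
    A * (sin (k * half_left a) ^+ 2)%:C = B * (sin (k * half_right a) ^+ 2)%:C].
Proof.
move=> k0 Epsi.
have kC0 : k%:C != 0 by rewrite eq_complex /= eqxx andbT gt_eqF.
have kk : k%:C * k%:C = (k ^+ 2)%:C by rewrite -rmorphM.
have [A [B [psiE C1 C2]]] := eigenspace_form a_gtN1 a_lt1 kC0 kk Epsi.
have [F1 F2] := half_angles C1 C2.
exists A, B; split.
- apply: filterS psiE => x /= + xI => /(_ xI) ->.
  rewrite /phi_left /phi_right /piecewise opprK; case: ifP => _.
    by rewrite mulr0 addr0 -rmorphM csin_real.
  by rewrite mulr0 add0r -rmorphM csin_real.
- by move: F1; rewrite -!rmorphM /= !csin_real !ccos_real -!rmorphM.
- by move: F2; rewrite -!rmorphM /= !csin_real -!rmorphXn.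
Qed.

(** The double primitive of [lam psi] is zero, which leaves a line plus [J] times the positive part
    of [x - c]. Vanishing at the right end fixes the left slope as [(a - 1) J / 2], so the right
    slope is [(a + 1) J / 2]. *)
Lemma eigenspace_zero psi : eigenspace_of (adjoint I0 (H a)) 0 psi ->
  exists A, eq_ae I0 psi (fun x => A * phi_affine a x).
Proof.
move=> /(adjoint_structure a_gtN1 a_lt1)[_ _ [_ [al1 [J1 [E1 Z1]]]] [_ [al2 [J2 [E2 Z2]]]]].
have P0 x : p <= x <= r -> prim p (fun=> 0) x = 0.
  by move=> /andP[px _]; rewrite prim_cst// mul0r.
have PP0 (q : R -> R) x : (forall t, q t = 0) -> p <= x <= r -> prim p (prim p q) x = 0.
  move=> q0 xI; rewrite (primE (g := fun=> 0) xI) ?P0// => t tI.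
  by rewrite (primE (g := fun=> 0) tI) ?P0.
have q1 t : Re (0 : R[i]) * Re (psi t) - Im (0 : R[i]) * Im (psi t) = 0 by rewrite /= !mul0r subrr.
have q2 t : Re (0 : R[i]) * Im (psi t) + Im (0 : R[i]) * Re (psi t) = 0 by rewrite /= !mul0r addr0.
have rI : p <= r <= r by rewrite lexx ltW.
have rJ : c <= r <= r by rewrite lexx ltW.
move: Z1 Z2; rewrite !PP0// (prim_after_right pc rJ) !subr0 => Z1 Z2.
have pi0 := @pi_gt0 R.
have al (x y : R) : x * (r - p) + y * (r - c) = 0 -> x = y / 2 * (a - 1).
  move=> h; have : pi * (x - y / 2 * (a - 1)) = 0 by rewrite -[RHS]h; field.
  by move/eqP; rewrite mulf_eq0 gt_eqF//= subr_eq0 => /eqP.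
exists ((J1 / 2) +i* (J2 / 2)).
apply: filterS2 E1 E2 => x /= e1 e2 xI.
have xJ : p <= x <= r by move: xI; rewrite /I0 /= in_itv /= => /andP[/ltW -> /ltW ->].
have -> : psi x = (Re (psi x)) +i* (Im (psi x)) by case: (psi x).
rewrite e1// e2// !PP0// (al _ _ Z1) (al _ _ Z2) /phi_affine /piecewise.
case: ltP => xc; simpc.
  rewrite (@prim_after_left _ p c); last by case/andP: xJ => -> _; rewrite ltW.
  by congr (_ +i* _); ring.
rewrite (@prim_after_right _ p r c pc); last by case/andP: xJ => _ ->; rewrite xc.
by congr (_ +i* _); field.
Qed.

(** The two terms have disjoint supports, and continuity up to [c] turns vanishing almost everywhere
    into vanishing everywhere. *)
Lemma piecewise_free A B (f g : R -> R) : cont p c f -> cont c r g ->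
  eq_ae I0 (fun x => A * piecewise a f (fun=> 0) x + B * piecewise a (fun=> 0) g x) (fun=> 0) ->
  (forall x, p <= x <= c -> A * (f x)%:C = 0) /\ (forall x, c <= x <= r -> B * (g x)%:C = 0).
Proof.
move=> cf cg E.
have El : eq_ae `]p, c[%classic (fun x => A * (f x)%:C) (fun=> 0).
  apply: filterS E => x /= h; rewrite in_itv /= => /andP[px xc].
  have := h _; rewrite /piecewise xc mulr0 addr0 => -> //.
  by rewrite /I0 /= in_itv /= px (lt_trans xc).
have Er : eq_ae `]c, r[%classic (fun x => B * (g x)%:C) (fun=> 0).
  apply: filterS E => x /= h; rewrite in_itv /= => /andP[cx xr].
  have := h _; rewrite /piecewise ltNge (ltW cx) mulr0 add0r => -> //.
  by rewrite /I0 /= in_itv /= xr (lt_trans pc).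
have key b e z (h : R -> R) : b < e -> cont b e h ->
    eq_ae `]b, e[%classic (fun x => z * (h x)%:C) (fun=> 0) ->
    forall x, b <= x <= e -> z * (h x)%:C = 0.
  move=> be ch Eh x xI.
  have h1 := fun E => @cont_eqae _ b e be (fun x => Re z * h x) (fun=> 0) (contZ ch) (@cont_cst _ _ _ 0) E x xI.
  have h2 := fun E => @cont_eqae _ b e be (fun x => Im z * h x) (fun=> 0) (contZ ch) (@cont_cst _ _ _ 0) E x xI.
  have R1 : eqae b e (fun x => Re z * h x) (fun=> 0).
    by apply: filterS Eh => y /= + yI => /(_ yI); case: (z) => z1 z2; simpc => -[].
  have R2 : eqae b e (fun x => Im z * h x) (fun=> 0).
    by apply: filterS Eh => y /= + yI => /(_ yI); case: (z) => z1 z2; simpc => -[].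
  move: (h1 R1) (h2 R2); case: (z) => z1 z2 /= e1 e2; simpc.
  by rewrite e1 e2.
by split; apply: key.
Qed.

Lemma cont_sin_aff b e (k d : R) : cont b e (fun x => sin (k * (x + d))).
Proof.
apply: cont_continuous => x.
have dx := der_comp_aff (is_derive_sin (k * (x + d))); exact: (der_continuous dx).
Qed.

Lemma exists_sin_neq0 (k l : R) : 0 < k -> 0 < l -> exists2 t, 0 <= t <= l & sin (k * t) != 0.
Proof.
move=> k0 l0; have pi0 := @pi_gt0 R.
have q0 : 0 < pi + k * l by rewrite addr_gt0// mulr_gt0.
have kl : 0 < k * l by rewrite mulr_gt0.
(* This number lies below both [l] and [pi / k], so its product with [k] lies strictly between 0 and
   [pi]. *)
exists (l * pi / (pi + k * l)).
  apply/andP; split; first by rewrite ltW// divr_gt0// mulr_gt0.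
  by rewrite ler_pdivrMr// ler_pM2l// lerDl ltW.
rewrite gt_eqF// sin_gt0_pi//; apply/andP; split.
  by rewrite mulr_gt0// divr_gt0// mulr_gt0.
rewrite mulrA ltr_pdivrMr//; nra.
Qed.

Lemma phi_free (k : R) A B : 0 < k ->
  eq_ae I0 (fun x => A * phi_left a k x + B * phi_right a k x) (fun=> 0) -> A = 0 /\ B = 0.
Proof.
move=> k0 E; have [EA EB] := piecewise_free (@cont_sin_aff _ _ _ _) (@cont_sin_aff _ _ _ _) E.
have lc : 0 < c - p by rewrite subr_gt0.
have rc : 0 < r - c by rewrite subr_gt0.
have [t tI s1] := exists_sin_neq0 k0 lc.
have [u uI s2] := exists_sin_neq0 k0 rc.
have z (x : R) : x != 0 -> x%:C != 0 by move=> x0; rewrite eq_complex /= eqxx andbT.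
split.
  have tE : p <= t + p <= c by case/andP: tI => t0 t1; rewrite lerDr t0 -lerBrDr.
  have := EA _ tE; rewrite subrK => /eqP.
  by rewrite mulf_eq0 (negbTE (z _ s1)) orbF => /eqP.
have uE : c <= r - u <= r by case/andP: uI => u0 u1; rewrite lerBrDl -lerBrDr u1 lerBlDr lerDl.
have := EB _ uE; rewrite addrAC subrr sub0r mulrN sinN => /eqP.
by rewrite mulf_eq0 (negbTE (z _ _)) ?oppr_eq0// orbF => /eqP.
Qed.

Lemma affine_neq0 : ~ eq_ae I0 (phi_affine a) (fun=> 0).
Proof.
move=> E.
have E' : eq_ae I0 (fun x => 1 * piecewise a (fun x => (a - 1) * (x + pi / 2)) (fun=> 0) x +
    1 * piecewise a (fun=> 0) (fun x => (a + 1) * (x - pi / 2)) x) (fun=> 0).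
  apply: filterS E => x /= + xI => /(_ xI); rewrite /phi_affine /piecewise !mul1r.
  by case: ifP => _ ->; rewrite ?addr0 ?add0r.
have caff b e (k d : R) : cont b e (fun x => k * (x + d)).
  by apply: cont_continuous => x; have dx := der_aff k d x; exact: (der_continuous dx).
have [h _] := piecewise_free (@caff _ _ _ _) (@caff _ _ _ _) E'.
have := h c; rewrite lexx ltW// => /(_ isT) /eqP; rewrite mul1r eq_complex /= eqxx andbT mulf_eq0 => /orP[].
  by rewrite subr_eq0 lt_eqF.
by rewrite addr_eq0 gt_eqF.
Qed.

End Eigenfunctions.

(** * The point spectrum *)

Section SineZeros.
Context {R : realType}.

Lemma sin_natpi (m : nat) : sin (m%:R * pi : R) = 0.
Proof.
elim: m => [|m IH]; first by rewrite mul0r sin0.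
by rewrite -addn1 natrD mulrDl mul1r sinDpi IH oppr0.
Qed.

(** With [m] the integer part of [x / pi], a nonzero remainder [x - m pi] would lie in []0, pi[],
    where the sine is positive. *)
Lemma sin_eq0_pos (x : R) : 0 < x -> sin x = 0 -> exists2 m, (0 < m)%N & x = m%:R * pi.
Proof.
move=> x0 sx0; have pi0 := @pi_gt0 R.
have q0 : 0 <= x / pi by rewrite ltW// divr_gt0.
pose m := Num.truncn (x / pi).
have /andP[m1 m2] : m%:R <= x / pi < m.+1%:R by exact: truncn_itv.
have xE : x = m%:R * pi.
  apply/eqP; rewrite eq_le; apply/andP; split; last by rewrite -ler_pdivlMr.
  rewrite leNgt; apply/negP => mx.
  have shift (y : R) n : sin (y + n%:R * pi) = 0 -> sin y = 0.
    elim: n y => [|n IH] y; first by rewrite mul0r addr0.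
    rewrite -addn1 natrD mulrDl mul1r addrA sinDpi => /eqP; rewrite oppr_eq0 => /eqP; exact: IH.
  have := shift (x - m%:R * pi) m; rewrite subrK => /(_ sx0) /eqP.
  apply/negP; rewrite gt_eqF// sin_gt0_pi// subr_gt0 mx /=.
  by rewrite ltrBlDr -[X in X + _]mul1r -mulrDl addrC natr1 -ltr_pdivrMr.
exists m => //; rewrite lt0n; apply/eqP => m0.
by move: x0; rewrite xE m0 mul0r ltxx.
Qed.

(** One statement for the three families: [d] is the length of the left part, of the right part or
    of the whole interval in units of [pi / 2], that is [1 + a], [1 - a] or [2]. *)
Lemma sin_freq_eq0 (k d : R) : 0 < k -> 0 < d ->
  sin (k * (pi * d / 4)) = 0 <-> exists2 m, (0 < m)%N & k = (4 * m)%:R / d.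
Proof.
move=> k0 d0; have pi0 := @pi_gt0 R; have dn0 := lt0r_neq0 d0; split=> [|[m _ ->]].
  move/sin_eq0_pos => []; first by rewrite !mulr_gt0// invr_gt0.
  move=> m m0 e; exists m => //; rewrite natrM.
  have {}e : k * d / 4 = m%:R.
    by apply: (mulfI (lt0r_neq0 pi0)); rewrite [RHS]mulrC -e; field.
  by rewrite -e; field.
rewrite (_ : _ * _ = m%:R * pi) ?sin_natpi// natrM.
by field.
Qed.

Lemma sin_add_eq0 (x y : R) : sin (x + y) = 0 -> sin x = 0 -> sin y = 0.
Proof.
rewrite sinD => + x0; rewrite x0 mul0r add0r; have := cos2Dsin2 x; rewrite x0.
by move: (cos x) (sin y) => C S; nra.
Qed.

(** When [x + y] is a multiple of [pi], [sin x = e sin y] and [cos x = - e cos y] for a common sign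
    [e]. This says that [A = B = 1] solves both matching conditions; the proof is algebraic, through
    [cos^2 + sin^2 = 1]. *)
Lemma sin_add_eq0_rel (x y : R) : sin (x + y) = 0 ->
  sin x * cos x = - (sin y * cos y) /\ sin x ^+ 2 = sin y ^+ 2.
Proof.
rewrite sinD; have := cos2Dsin2 x; have := cos2Dsin2 y.
move: (cos x) (sin x) (cos y) (sin y) => C S D T h1 h2 h3.
have {}h3 : S * D = - (C * T) by lra.
split.
  transitivity (S * C * (D ^+ 2 + T ^+ 2)); first by rewrite h1 mulr1.
  transitivity (C * D * (S * D) + S * C * T ^+ 2); first by ring.
  rewrite h3; transitivity (- (C ^+ 2 * T * D) - T * S * - (C * T)); first by ring.
  rewrite -h3; transitivity (- ((C ^+ 2 + S ^+ 2) * (T * D))); first by ring.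
  by rewrite h2 mul1r.
transitivity (S ^+ 2 * (D ^+ 2 + T ^+ 2)); first by rewrite h1 mulr1.
transitivity ((S * D) ^+ 2 + S ^+ 2 * T ^+ 2); first by ring.
rewrite h3; transitivity ((C ^+ 2 + S ^+ 2) * T ^+ 2); first by ring.
by rewrite h2 mul1r.
Qed.

Lemma sqr_complex_inj (k l : R) : 0 < k -> 0 < l -> (k ^+ 2)%:C = (l ^+ 2)%:C -> k = l.
Proof.
by move=> k0 l0 [] /eqP; rewrite eqrXn2 ?ltW// => /eqP.
Qed.

End SineZeros.

(** * Simple eigenvalues *)

Section OneDimensional.
Context {R : realType} (Omega : set R) (T : (R -> R[i]) -> (R -> R[i]) -> Prop).
Implicit Types (lam : R[i]) (psi : R -> R[i]).

Lemma the_eigenfunction_intro lam psi0 : eigenfunction Omega T lam psi0 ->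
  (forall psi, eigenspace_of T lam psi -> exists c, eq_ae Omega psi (fun x => c * psi0 x)) ->
  the_eigenfunction Omega T lam psi0.
Proof.
move=> E0 Espan; split=> // psi [Epsi psi0N].
have [c cE] := Espan _ Epsi; exists c => //; apply/eqP => c0; apply: psi0N.
by apply: filterS cE => x /= + xO => /(_ xO) ->; rewrite c0 mul0r.
Qed.

Lemma the_eigenfunction_mult1 lam psi0 : the_eigenfunction Omega T lam psi0 ->
  geometric_multiplicity Omega T lam 1.
Proof.
move=> [[E0 N0] span]; exists [tuple psi0]; split.
- by move=> i; rewrite ord1.
- move=> c cE i; rewrite ord1; apply/eqP/negPn/negP => c0; apply: N0.
  apply: filterS cE => x /= + xO => /(_ xO); rewrite big_ord1 /= => /eqP.
  by rewrite mulf_eq0 (negbTE c0) => /eqP.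
(* [the_eigenfunction] speaks of nonzero vectors only, so null functions are treated apart with
   coefficient 0. *)
- move=> psi Epsi; have [z|nz] := pselect (eq_ae Omega psi (fun=> 0)).
    exists (fun=> 0); apply: filterS z => x /= + xO => /(_ xO) ->.
    by rewrite big_ord1 mul0r.
  have [c _ cE] := span psi (conj Epsi nz).
  by exists (fun=> c); apply: filterS cE => x /= + xO => /(_ xO) ->; rewrite big_ord1.
Qed.

End OneDimensional.

(** * The three families of eigenvalues and their intersections *)

Section Spectrum.
Context {R : realType} (a : R).
Hypotheses (a_gtN1 : -1 < a) (a_lt1 : a < 1).
Implicit Types (k : R) (lam : R[i]) (psi : R -> R[i]) (m : nat).
Local Notation Hstar := (adjoint I0 (H a)).
Local Notation sleft k := (sin (k * half_left a)).
Local Notation sright k := (sin (k * half_right a)).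

Let d1 : 0 < 1 + a. Proof. by have h := a_gtN1; lra. Qed.
Let d2 : 0 < 1 - a. Proof. by have h := a_lt1; lra. Qed.

Lemma freq_plus_gt0 m : (0 < m)%N -> 0 < freq_plus a m.
Proof. by move=> m0; rewrite divr_gt0// ltr0n muln_gt0. Qed.

Lemma freq_minus_gt0 m : (0 < m)%N -> 0 < freq_minus a m.
Proof. by move=> m0; rewrite divr_gt0// ltr0n muln_gt0. Qed.

Lemma freq_zero_gt0 m : (0 < m)%N -> 0 < freq_zero m :> R.
Proof. by move=> m0; rewrite ltr0n muln_gt0. Qed.

Lemma sigma_plusP k : 0 < k -> sigma_plus a (k ^+ 2)%:C <-> sleft k = 0.
Proof.
move=> k0; rewrite /half_left (sin_freq_eq0 k0 d1); split=> -[m m0 e]; exists m => //; last by rewrite e.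
exact: (sqr_complex_inj k0 (freq_plus_gt0 m0)).
Qed.

Lemma sigma_minusP k : 0 < k -> sigma_minus a (k ^+ 2)%:C <-> sright k = 0.
Proof.
move=> k0; rewrite /half_right (sin_freq_eq0 k0 d2); split=> -[m m0 e]; exists m => //; last by rewrite e.
exact: (sqr_complex_inj k0 (freq_minus_gt0 m0)).
Qed.

Lemma sigma_zeroP k : 0 < k ->
  sigma_zero (k ^+ 2)%:C <-> sin (k * half_left a + k * half_right a) = 0.
Proof.
move=> k0; have -> : k * half_left a + k * half_right a = k * (pi * 2 / 4).
  by rewrite /half_left /half_right; field.
rewrite (sin_freq_eq0 k0 (ltr0n R 2)); split=> [[m e]|[m m0 e]].
  (* Unlike the other two families, [sigma_zero] starts at [m = 0], which [0 < k] excludes. *)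
  have m0 : (0 < m)%N.
    rewrite lt0n; apply/eqP => m0; move: e; rewrite m0 /freq_zero => -[] /eqP.
    by rewrite muln0 expr0n /= sqrf_eq0 gt_eqF.
  exists m => //; rewrite (sqr_complex_inj k0 (freq_zero_gt0 m0) e) /freq_zero !natrM.
  by field.
by exists m; rewrite e /freq_zero !natrM; congr ((_ ^+ 2)%:C); field.
Qed.

Lemma eigen_left k : 0 < k -> sleft k = 0 -> eigenfunction I0 Hstar (k ^+ 2)%:C (phi_left a k).
Proof.
move=> k0 s0; split.
  rewrite (_ : phi_left a k = piecewise a (fun x => 1 * sin (k * (x + pi / 2)))
      (fun x => 0 * sin (k * (x - pi / 2)))); last first.
    by apply/funext => x; rewrite /phi_left /piecewise mul1r mul0r.
  by apply: oscillating_eigen => //; rewrite s0 ?expr0n /= !(mul0r, mulr0) ?oppr0.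
move=> E; have [/eqP] : 1 = 0 :> R[i] /\ 0 = 0 :> R[i]; last by rewrite oner_eq0.
apply: (phi_free a_gtN1 a_lt1 k0).
by apply: filterS E => x /= + xI => /(_ xI) ->; rewrite mul0r addr0 mulr0.
Qed.

Lemma eigen_right k : 0 < k -> sright k = 0 -> eigenfunction I0 Hstar (k ^+ 2)%:C (phi_right a k).
Proof.
move=> k0 s0; split.
  rewrite (_ : phi_right a k = piecewise a (fun x => 0 * sin (k * (x + pi / 2)))
      (fun x => 1 * sin (k * (x - pi / 2)))); last first.
    by apply/funext => x; rewrite /phi_right /piecewise mul1r mul0r.
  by apply: oscillating_eigen => //; rewrite s0 ?expr0n /= !(mul0r, mulr0) ?oppr0.
move=> E; have [_ /eqP] : 0 = 0 :> R[i] /\ 1 = 0 :> R[i]; last by rewrite oner_eq0.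
apply: (phi_free a_gtN1 a_lt1 k0).
by apply: filterS E => x /= + xI => /(_ xI) ->; rewrite mul0r add0r mulr0.
Qed.

Lemma phi_bothE k x : phi_both a k x = phi_left a k x + phi_right a k x.
Proof. by rewrite /phi_both /phi_left /phi_right /piecewise; case: ifP => _; rewrite ?addr0 ?add0r. Qed.

Lemma eigen_both k : 0 < k -> sin (k * half_left a + k * half_right a) = 0 ->
  eigenfunction I0 Hstar (k ^+ 2)%:C (phi_both a k).
Proof.
move=> k0 /sin_add_eq0_rel[e1 e2]; split.
  rewrite (_ : phi_both a k = piecewise a (fun x => 1 * sin (k * (x + pi / 2)))
      (fun x => 1 * sin (k * (x - pi / 2)))); last first.
    by apply/funext => x; rewrite /phi_both /piecewise !mul1r.
  by apply: oscillating_eigen => //; rewrite !mul1r.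
move=> E; have [/eqP] : 1 = 0 :> R[i] /\ 1 = 0 :> R[i]; last by rewrite oner_eq0.
apply: (phi_free a_gtN1 a_lt1 k0).
by apply: filterS E => x /= + xI => /(_ xI) <-; rewrite !mul1r phi_bothE.
Qed.

Let realC_neq0 (x : R) : x != 0 -> x%:C != 0.
Proof. by move=> x0; rewrite eq_complex /= eqxx andbT. Qed.

Lemma the_left k : 0 < k -> sleft k = 0 -> sright k != 0 ->
  the_eigenfunction I0 Hstar (k ^+ 2)%:C (phi_left a k).
Proof.
move=> k0 s1 s2; apply: the_eigenfunction_intro; first exact: eigen_left.
move=> psi /(eigenspace_pos a_gtN1 a_lt1 k0)[A [B [E _ E2]]]; exists A.
have B0 : B = 0.
  move/eqP: E2; rewrite s1 expr0n /= mulr0 eq_sym mulf_eq0 => /orP[/eqP//|].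
  by rewrite (negbTE (realC_neq0 _))// expf_neq0.
by apply: filterS E => x /= + xI => /(_ xI) ->; rewrite B0 mul0r addr0.
Qed.

Lemma the_right k : 0 < k -> sright k = 0 -> sleft k != 0 ->
  the_eigenfunction I0 Hstar (k ^+ 2)%:C (phi_right a k).
Proof.
move=> k0 s2 s1; apply: the_eigenfunction_intro; first exact: eigen_right.
move=> psi /(eigenspace_pos a_gtN1 a_lt1 k0)[A [B [E _ E2]]]; exists B.
have A0 : A = 0.
  move/eqP: E2; rewrite s2 expr0n /= mulr0 mulf_eq0 => /orP[/eqP//|].
  by rewrite (negbTE (realC_neq0 _))// expf_neq0.
by apply: filterS E => x /= + xI => /(_ xI) ->; rewrite A0 mul0r add0r.
Qed.

Lemma the_both k : 0 < k -> sin (k * half_left a + k * half_right a) = 0 -> sleft k != 0 ->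
  the_eigenfunction I0 Hstar (k ^+ 2)%:C (phi_both a k).
Proof.
move=> k0 s s1; apply: the_eigenfunction_intro; first exact: eigen_both.
move=> psi /(eigenspace_pos a_gtN1 a_lt1 k0)[A [B [E _ E2]]]; exists A.
have AB : A = B.
  (* The squares of the two sines agree, so a common nonzero factor cancels. *)
  move: E2; rewrite -(sin_add_eq0_rel s).2 => E2.
  by apply: mulIf E2; apply: realC_neq0; rewrite expf_neq0.
by apply: filterS E => x /= + xI => /(_ xI) ->; rewrite phi_bothE -AB mulrDr.
Qed.

Lemma the_affine : the_eigenfunction I0 Hstar 0 (phi_affine a).
Proof.
apply: the_eigenfunction_intro; last exact: eigenspace_zero.
by split; [exact: affine_eigen|exact: affine_neq0].
Qed.

Lemma phi_pair_free k : 0 < k -> free_ae I0 [tuple phi_right a k; phi_left a k].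
Proof.
move=> k0 e eE.
have [e1 e0] : e (@Ordinal 2 1 isT) = 0 /\ e (@Ordinal 2 0 isT) = 0.
  apply: (phi_free a_gtN1 a_lt1 k0); apply: filterS eE => x /= + xI => /(_ xI) <-.
  rewrite big_ord_recl big_ord1 addrC; congr (_ + _).
    by congr (e _ * _); exact: val_inj.
  by congr (e _ * _); exact: val_inj.
move=> [[|[|//]] i2]; first by rewrite -[RHS]e0; congr (e _); exact: val_inj.
by rewrite -[RHS]e1; congr (e _); exact: val_inj.
Qed.

Lemma mult2 k : 0 < k -> sleft k = 0 -> sright k = 0 ->
  geometric_multiplicity I0 Hstar (k ^+ 2)%:C 2.
Proof.
move=> k0 s1 s2; exists [tuple phi_right a k; phi_left a k]; split.
- by move=> [[|[|//]] i2] /=; [exact: (eigen_right k0 s2).1|exact: (eigen_left k0 s1).1].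
- exact: phi_pair_free.
move=> psi /(eigenspace_pos a_gtN1 a_lt1 k0)[A [B [E _ _]]].
exists (fun i => if val i == 0%N then B else A).
by apply: filterS E => x /= + xI => /(_ xI) ->; rewrite big_ord_recl big_ord1 /= addrC.
Qed.

Lemma spectrum_freq lam : point_spectrum I0 Hstar lam -> lam = 0 \/
  exists k, [/\ 0 < k, lam = (k ^+ 2)%:C & [\/ sleft k = 0, sright k = 0 |
    sin (k * half_left a + k * half_right a) = 0]].
Proof.
move=> [psi Epsi]; have [->|lam0] := eqVneq lam 0; [by left|right].
have [k k0 lamE] := eigenvalue_real a_gtN1 a_lt1 Epsi lam0; exists k; split=> //.
have [s1|s1] := eqVneq (sleft k) 0; first by constructor 1.
have [s2|s2] := eqVneq (sright k) 0; first by constructor 2.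
constructor 3; move: Epsi; rewrite lamE => -[/(eigenspace_pos a_gtN1 a_lt1 k0)[A [B [E E1 E2]]] N].
have B0 : B != 0.
  apply/eqP => B0; apply: N; apply: filterS E => x /= + xI => /(_ xI) ->.
  move/eqP: E2; rewrite B0 mul0r mulf_eq0 (negbTE (realC_neq0 _)) ?expf_neq0// orbF => /eqP ->.
  by rewrite !mul0r addr0.
rewrite sinD; move: s1 s2 E1 E2; move: (sin _) (cos _) (sin _) (cos _) => t1 u1 t2 u2 s1 s2 E1 E2.
(* Elimination of [A], mirroring that of [B] in [eigenvalue_real]: here [t1], [u1] belong to the
   right part and [t2], [u2] to the left, and the second factor is the sine of the sum. *)
have e : B * (t1 * (t2 * u1 + u2 * t1))%:C = 0.
  transitivity (B * (t1 ^+ 2)%:C * u2%:C + B * (t1 * u1)%:C * t2%:C).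
    by rewrite -!mulrA -!rmorphM -mulrDr -rmorphD; congr (_ * _%:C); ring.
  rewrite -E2 -[B * (t1 * u1)%:C]opprK -E1.
  by rewrite mulNr -!mulrA -!rmorphM -mulrBr -rmorphB (_ : _ - _ = 0) ?mulr0//; ring.
move/eqP: e; rewrite mulf_eq0 (negbTE B0) /= => /eqP[] /eqP.
by rewrite mulf_eq0 (negbTE s2) => /eqP.
Qed.

Lemma point_spectrumE :
  point_spectrum I0 Hstar = sigma_minus a `|` sigma_plus a `|` sigma_zero.
Proof.
apply/seteqP; split=> lam.
  move=> /spectrum_freq[->|[k [k0 -> [s|s|s]]]].
  - by right; exists 0%N; rewrite /freq_zero muln0 expr0n.
  - by left; right; apply/sigma_plusP.
  - by left; left; apply/sigma_minusP.
  - by right; apply/sigma_zeroP.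
move=> [[[m m0 ->]|[m m0 ->]]|[m ->]].
- exists (phi_right a (freq_minus a m)); apply: eigen_right (freq_minus_gt0 m0) _.
  by apply/(sigma_minusP (freq_minus_gt0 m0)); exists m.
- exists (phi_left a (freq_plus a m)); apply: eigen_left (freq_plus_gt0 m0) _.
  by apply/(sigma_plusP (freq_plus_gt0 m0)); exists m.
- have [->|] := posnP m.
    exists (phi_affine a); rewrite /freq_zero muln0 expr0n; exact: the_affine.1.
  move=> m0; exists (phi_both a (freq_zero m)); apply: eigen_both (freq_zero_gt0 m0) _.
  by apply/(sigma_zeroP (freq_zero_gt0 m0)); exists m.
Qed.

Lemma mult1 lam : point_spectrum I0 Hstar lam ->
  ~ (sigma_minus a `&` sigma_plus a) lam -> geometric_multiplicity I0 Hstar lam 1.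
Proof.
move=> /spectrum_freq[->|[k [k0 -> h]]] N.
  exact: the_eigenfunction_mult1 the_affine.
have {}N : ~ (sright k = 0 /\ sleft k = 0).
  by move=> [/(sigma_minusP k0) s2 /(sigma_plusP k0) s1]; apply: N.
have [s1|s1] := eqVneq (sleft k) 0.
  apply: (the_eigenfunction_mult1 (the_left k0 s1 _)).
  by apply/eqP => s2; apply: N.
case: h => [/eqP|s2|s]; first by rewrite (negbTE s1).
- exact: (the_eigenfunction_mult1 (the_right k0 s2 s1)).
- exact: (the_eigenfunction_mult1 (the_both k0 s s1)).
Qed.

Lemma the_freq_minus m : (0 < m)%N ->
  ~ (sigma_minus a `&` sigma_plus a) (freq_minus a m ^+ 2)%:C ->
  the_eigenfunction I0 Hstar (freq_minus a m ^+ 2)%:C (phi_right a (freq_minus a m)).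
Proof.
move=> m0 N; have k0 := freq_minus_gt0 m0.
have s : sigma_minus a (freq_minus a m ^+ 2)%:C by exists m.
apply: the_right => //; first exact/sigma_minusP.
by apply/eqP => s1; apply: N; split=> //; apply/sigma_plusP.
Qed.

Lemma the_freq_plus m : (0 < m)%N ->
  ~ (sigma_minus a `&` sigma_plus a) (freq_plus a m ^+ 2)%:C ->
  the_eigenfunction I0 Hstar (freq_plus a m ^+ 2)%:C (phi_left a (freq_plus a m)).
Proof.
move=> m0 N; have k0 := freq_plus_gt0 m0.
have s : sigma_plus a (freq_plus a m ^+ 2)%:C by exists m.
apply: the_left => //; first exact/sigma_plusP.
by apply/eqP => s1; apply: N; split=> //; apply/sigma_minusP.
Qed.

Lemma the_freq_zero m : (0 < m)%N ->
  ~ (sigma_minus a `&` sigma_plus a) (freq_zero m ^+ 2)%:C ->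
  the_eigenfunction I0 Hstar (freq_zero m ^+ 2)%:C (phi_both a (freq_zero m)).
Proof.
move=> m0 N; have k0 : 0 < freq_zero m :> R := freq_zero_gt0 m0.
have s : sin (freq_zero m * half_left a + freq_zero m * half_right a) = 0.
  by apply/(sigma_zeroP k0); exists m.
(* If the left sine vanished, the vanishing sine of the sum would force the right one to vanish
   too. *)
apply: the_both => //; apply/eqP => s1; apply: N; split; last exact/sigma_plusP.
by apply/sigma_minusP => //; exact: sin_add_eq0 s s1.
Qed.

(** By the addition formula, if two of [sin x], [sin y] and [sin (x + y)] vanish, so does the third.
    Every question about intersections thus reduces to [sigma_minus] and [sigma_plus]. *)
Lemma sigma_capE :
  [/\ sigma_minus a `&` sigma_plus a `<=` sigma_zero,
      sigma_minus a `&` sigma_zero `<=` sigma_plus a &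
      sigma_plus a `&` sigma_zero `<=` sigma_minus a].
Proof.
split=> lam [[m m0 lamE]].
- have k0 := freq_minus_gt0 m0; rewrite lamE => /(sigma_plusP k0) s1.
  have /(sigma_minusP k0) s2 : sigma_minus a (freq_minus a m ^+ 2)%:C by exists m.
  by apply/(sigma_zeroP k0); rewrite sinD s1 s2 mul0r mulr0 addr0.
- have k0 := freq_minus_gt0 m0; rewrite lamE => /(sigma_zeroP k0) s.
  have /(sigma_minusP k0) s2 : sigma_minus a (freq_minus a m ^+ 2)%:C by exists m.
  by apply/(sigma_plusP k0); apply: sin_add_eq0 s2; rewrite addrC.
- have k0 := freq_plus_gt0 m0; rewrite lamE => /(sigma_zeroP k0) s.
  have /(sigma_plusP k0) s1 : sigma_plus a (freq_plus a m ^+ 2)%:C by exists m.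
  by apply/(sigma_minusP k0); exact: sin_add_eq0 s s1.
Qed.

(** Equality of [4m / (1 - a)] and [4n / (1 + a)] gives [a = (n - m) / (n + m)]. *)
Lemma sigma_cap_rational lam : (sigma_minus a `&` sigma_plus a) lam -> rational a.
Proof.
move=> [[m m0 ->] [n n0 e]].
have {}e := sqr_complex_inj (freq_minus_gt0 m0) (freq_plus_gt0 n0) e.
apply/rationalP; exists (n%:Z - m%:Z), (n + m)%N.
have mR : 0 < m%:R :> R by rewrite ltr0n.
have nR : 0 < n%:R :> R by rewrite ltr0n.
rewrite rmorphB /= natrD; move: e; rewrite /freq_minus /freq_plus !natrM.
have d1' := d1; have d2' := d2.
move/eqP; rewrite eqr_div ?lt0r_neq0// => /eqP e.
apply: (mulIf (lt0r_neq0 (addr_gt0 nR mR))).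
by rewrite divfK ?lt0r_neq0 ?addr_gt0//; lra.
Qed.

(** If [a = z / D] with [D > 0], then [D - z] and [D + z] are positive integers, and as indices in
    the two families they both give the frequency [4 D]. *)
Lemma rational_sigma_cap : rational a -> sigma_minus a `&` sigma_plus a !=set0.
Proof.
move=> [q _]; have [z d _] := ratP q; rewrite fmorph_div /= ratr_nat ratr_int => aE.
have b0 : 0 < d.+1%:R :> R by rewrite ltr0n.
have nat_of (y : int) : 0 < y%:~R :> R -> exists2 m, (0 < m)%N & y%:~R = m%:R :> R.
  rewrite ltr0z => y0; exists `|y|%N; first by rewrite absz_gt0 gt_eqF.
  by rewrite natr_absz gtr0_norm.
have zE : z%:~R = a * d.+1%:R by rewrite -aE divfK// lt0r_neq0.
have d1' := d1; have d2' := d2.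
have [m m0 mE] : exists2 m, (0 < m)%N & (1 + a) * d.+1%:R = m%:R.
  have -> : (1 + a) * d.+1%:R = (d.+1%:Z + z)%:~R :> R by rewrite rmorphD /= zE mulrDl mul1r.
  by apply: nat_of; rewrite rmorphD /= zE -[X in X + _]mul1r -mulrDl mulr_gt0.
have [n n0 nE] : exists2 m, (0 < m)%N & (1 - a) * d.+1%:R = m%:R.
  have -> : (1 - a) * d.+1%:R = (d.+1%:Z - z)%:~R :> R by rewrite rmorphB /= zE mulrBl mul1r.
  by apply: nat_of; rewrite rmorphB /= zE -[X in X - _]mul1r -mulrBl mulr_gt0.
exists ((freq_minus a n ^+ 2)%:C); split; first by exists n.
exists m => //; congr ((_ ^+ 2)%:C); rewrite /freq_minus /freq_plus !natrM -mE -nE.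
by move: d.+1%:R => D; field; rewrite !lt0r_neq0.
Qed.

End Spectrum.

Theorem proposition2 (R : realType) (a : R) (a_gtN1 : -1 < a) (a_lt1 : a < 1) :
  let Hstar := adjoint I0 (H a) in
  [/\ point_spectrum I0 Hstar = sigma_minus a `|` sigma_plus a `|` sigma_zero,
      (irrational a ->
        [/\ [/\ sigma_minus a `&` sigma_plus a = set0,
                sigma_minus a `&` sigma_zero = set0 &
                sigma_plus a `&` sigma_zero = set0],
            (forall lam, point_spectrum I0 Hstar lam ->
              geometric_multiplicity I0 Hstar lam 1) &
            [/\ (forall m, (0 < m)%N ->
                  the_eigenfunction I0 Hstar (freq_minus a m ^+ 2)%:C
                    (phi_right a (freq_minus a m))),
                (forall m, (0 < m)%N ->
                  the_eigenfunction I0 Hstar (freq_plus a m ^+ 2)%:C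
                    (phi_left a (freq_plus a m))),
                (forall m, (0 < m)%N ->
                  the_eigenfunction I0 Hstar (freq_zero m ^+ 2)%:C
                    (phi_both a (freq_zero m))) &
                the_eigenfunction I0 Hstar 0 (phi_affine a)]]) &
      (rational a ->
        [/\ sigma_minus a `&` sigma_plus a =
              sigma_minus a `&` sigma_plus a `&` sigma_zero /\
            sigma_minus a `&` sigma_plus a !=set0,
            (forall k : R, 0 < k ->
              (sigma_minus a `&` sigma_plus a) (k ^+ 2)%:C ->
              [/\ geometric_multiplicity I0 Hstar (k ^+ 2)%:C 2,
                  eigenfunction I0 Hstar (k ^+ 2)%:C (phi_right a k),
                  eigenfunction I0 Hstar (k ^+ 2)%:C (phi_left a k) &
                  free_ae I0 [tuple phi_right a k; phi_left a k]]),
            (forall lam,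
              (point_spectrum I0 Hstar `\`
                (sigma_minus a `&` sigma_plus a)) lam ->
              geometric_multiplicity I0 Hstar lam 1),
            [/\ (forall m, (0 < m)%N ->
                  ~ (sigma_minus a `&` sigma_plus a) (freq_minus a m ^+ 2)%:C ->
                  the_eigenfunction I0 Hstar (freq_minus a m ^+ 2)%:C
                    (phi_right a (freq_minus a m))),
                (forall m, (0 < m)%N ->
                  ~ (sigma_minus a `&` sigma_plus a) (freq_plus a m ^+ 2)%:C ->
                  the_eigenfunction I0 Hstar (freq_plus a m ^+ 2)%:C
                    (phi_left a (freq_plus a m))),
                (forall m, (0 < m)%N ->
                  ~ (sigma_minus a `&` sigma_plus a) (freq_zero m ^+ 2)%:C ->
                  the_eigenfunction I0 Hstar (freq_zero m ^+ 2)%:C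
                    (phi_both a (freq_zero m))) &
                the_eigenfunction I0 Hstar 0 (phi_affine a)] &
            geometric_multiplicity I0 Hstar 0 1])].
Proof.
move=> Hstar; have [mp_z mz_p pz_m] := sigma_capE a_gtN1 a_lt1.
have aff := the_affine a_gtN1 a_lt1.
split.
- exact: point_spectrumE.
- move=> irr.
  (* An empty intersection makes the side conditions of the simple case hold throughout. *)
  have N lam : ~ (sigma_minus a `&` sigma_plus a) lam.
    by move=> /(sigma_cap_rational a_gtN1 a_lt1); exact: irr.
  split.
  + split; rewrite -subset0 => lam h.
    * exact: (N lam h).
    * by apply: (N lam); split; [exact: h.1|exact: mz_p].
    * by apply: (N lam); split; [exact: pz_m|exact: h.1].
  + by move=> lam lamS; apply: mult1.
  + split=> // m m0.
    * exact: the_freq_minus.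
    * exact: the_freq_plus.
    * exact: the_freq_zero.
- move=> rat; split.
  + split; last exact: rational_sigma_cap.
    by apply/seteqP; split=> lam h; [split=> //; exact: mp_z|exact: h.1].
  + move=> k k0 [/(sigma_minusP a_lt1 k0) s2 /(sigma_plusP a_gtN1 k0) s1]; split.
    * exact: mult2.
    * exact: eigen_right.
    * exact: eigen_left.
    * exact: phi_pair_free.
  + by move=> lam [lamS N]; exact: mult1.
  + split=> //.
    * exact: the_freq_minus.
    * exact: the_freq_plus.
    * exact: the_freq_zero.
  + exact: the_eigenfunction_mult1 aff.
Qed.
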